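(* For every fixed $r > 0$, the function $$s \mapsto \theta_3(rs)\,\theta_3\!\left(\frac{r}{s}\right) - 2\,\theta_o(rs)\,\theta_o\!\left(\frac{r}{s}\right), \qquad s>0,$$ attains its minimum at $s = 1$.
   Context: For $s>0$, $\theta_3(s) = \sum_{k\in\mathbb{Z}} e^{-\pi k^2 s}$ and $\theta_o(s) = \sum_{k\in\mathbb{Z}} e^{-\pi (2k+1)^2 s}$. *)

(* Defs.v *)
From Stdlib Require Import Reals ZArith ClassicalEpsilon.
Open Scope R_scope.

Definition sumZ_partial (f : Z -> R) (N : nat) : R :=
  sum_f_R0 (fun i => f (Z.of_nat i - Z.of_nat N)%Z) (2 * N).

Definition sumZ_cv (f : Z -> R) (l : R) : Prop := Un_cv (sumZ_partial f) l.

(* The value of the bilateral sum (chosen by classical choice;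
   meaningful whenever the series converges, which holds for the
   absolutely convergent theta series below). *)
Definition sumZ (f : Z -> R) : R :=
  epsilon (inhabits 0) (fun l => sumZ_cv f l).

Definition theta3 (s : R) : R :=
  sumZ (fun k => exp (- PI * (IZR k) ^ 2 * s)).

Definition theta_o (s : R) : R :=
  sumZ (fun k => exp (- PI * (2 * IZR k + 1) ^ 2 * s)).

Definition F5 (r s : R) : R :=
  theta3 (r * s) * theta3 (r / s) - 2 * theta_o (r * s) * theta_o (r / s).

(* Main.v *)
Require Import Defs.
From Stdlib Require Import Reals ZArith ClassicalEpsilon Lra Lia.
From Coquelicot Require Import Coquelicot.
Open Scope R_scope.

(** Split [theta3 = ev + od] into the sums over even and odd integers, so that
    [F5 r s = ev x ev y + ev x od y + od x ev y - od x od y] with [x = r s], [y = r / s].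
    The inversion formula [theta3 (1/s) = sqrt s theta3 s] acts on the vector [(ev, od)] by the
    Hadamard matrix: [(ev, od) (1/(4w)) = sqrt w (ev + od, ev - od) (w)].  Hence
    [F5 r s = 2 sqrt w (ev x ev w + od x od w)] with [w = s / (4r)], and
    [F5 (1/(4r)) s = 2 r F5 r s]; together with the symmetry [s <-> 1/s] this reduces the claim
    to [r >= 1/2] and [s >= 1], where [F5 r] is nondecreasing in [s].
    For [s <= 2r] we have [x >= y >= 1/2] and the derivative is a sum of differences that are
    nonnegative because [- t ev'/theta3] and [- t od'] decrease while [ev - od] increases on
    [1/2, oo).  For [s >= 2r] the dual expression has [x, w >= 1/2], and its derivative is
    [- 2 sqrt w / s * Phi x w], where [Phi] decreases in both variables and vanishes at the
    self-dual point [x = w = 1/2].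

    The inversion formula itself is the limit of an identity on the cycle [Z/(2n+1)]: the return
    probability of the random walk, computed spectrally and by counting paths.  The limits are
    taken with Tannery's theorem, and the constant is found by setting [s = 1]. *)

(** * Finite sums and convergence of series *)

Fixpoint psum (f : nat -> R) (n : nat) : R :=
  match n with O => 0 | S p => psum f p + f p end.

Lemma psum_ext f g n : (forall k, (k < n)%nat -> f k = g k) -> psum f n = psum g n.
Proof.
  induction n as [|n IH]; intros H; [reflexivity|simpl].
  rewrite IH by (intros; apply H; lia). now rewrite H by lia.
Qed.

Lemma psum_split f a b : psum f (a + b) = psum f a + psum (fun k => f (a + k)%nat) b.
Proof.
  induction b as [|b IH]; [rewrite Nat.add_0_r; simpl; ring|].
  rewrite Nat.add_succ_r; simpl; rewrite IH; ring.
Qed.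

Lemma psum_0 n : psum (fun _ => 0) n = 0.
Proof. induction n as [|n IH]; simpl; [|rewrite IH]; ring. Qed.

Lemma psum_plus f g n : psum (fun k => f k + g k) n = psum f n + psum g n.
Proof. induction n as [|n IH]; simpl; [|rewrite IH]; ring. Qed.

Lemma psum_scal a f n : psum (fun k => a * f k) n = a * psum f n.
Proof. induction n as [|n IH]; simpl; [|rewrite IH]; ring. Qed.

Lemma psum_switch (f : nat -> nat -> R) n m :
  psum (fun i => psum (fun j => f i j) m) n = psum (fun j => psum (fun i => f i j) n) m.
Proof.
  induction n as [|n IH]; simpl.
  - now rewrite psum_0.
  - rewrite IH, <- psum_plus. reflexivity.
Qed.

Lemma psum_sum_n f n : sum_n f n = psum f (S n).
Proof.
  induction n as [|n IH]; [rewrite sum_O; simpl; now rewrite Rplus_0_l|].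
  rewrite sum_Sn, IH. reflexivity.
Qed.

Lemma is_series_psum f l : is_series f l <-> is_lim_seq (psum f) l.
Proof.
  split; intros H.
  - apply is_lim_seq_incr_1. apply is_lim_seq_ext with (sum_n f); [apply psum_sum_n|exact H].
  - apply is_lim_seq_incr_1 in H. apply (is_lim_seq_ext _ (sum_n f)) in H; [exact H|].
    intros; symmetry; apply psum_sum_n.
Qed.

Lemma is_series_finite f n : (forall k, (n <= k)%nat -> f k = 0) -> is_series f (psum f n).
Proof.
  intros H. apply is_series_psum. apply (is_lim_seq_incr_n _ n).
  apply is_lim_seq_ext with (fun _ => psum f n); [|apply is_lim_seq_const].
  intros k. rewrite Nat.add_comm, psum_split.
  rewrite (psum_ext (fun i => f (n + i)%nat) (fun _ => 0)) by (intros; apply H; lia). rewrite psum_0; ring.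
Qed.

Lemma Series_le_gen (a b : nat -> R) :
  (forall k, a k <= b k) -> ex_series a -> ex_series b -> Series a <= Series b.
Proof.
  intros H Ha Hb.
  assert (0 <= Series b - Series a); [|lra].
  rewrite <- Series_minus by assumption.
  replace 0 with (Series (fun n => 0 * 0)) by (rewrite Series_scal_l; ring).
  apply Series_le; [intros n; specialize (H n); lra|].
  now apply @ex_series_minus.
Qed.

Lemma Series_nonneg (a : nat -> R) : (forall k, 0 <= a k) -> ex_series a -> 0 <= Series a.
Proof.
  intros H Ha.
  replace 0 with (Series (fun n => 0 * 0)) by (rewrite Series_scal_l; ring).
  apply Series_le; [intros n; specialize (H n); lra|assumption].
Qed.

Lemma ex_series_geom_bound (a : nat -> R) (M q : R) :
  0 <= q < 1 -> (forall k, Rabs (a k) <= M * q ^ k) -> ex_series a.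
Proof.
  intros Hq H. apply (@ex_series_le _ R_CompleteNormedModule _ (fun k => M * q ^ k)).
  - exact H.
  - apply (@ex_series_scal_l R_AbsRing). apply ex_series_geom. rewrite Rabs_pos_eq; lra.
Qed.

Lemma Series_geom_bound (a : nat -> R) (M q : R) :
  0 <= q < 1 -> (forall k, Rabs (a k) <= M * q ^ k) -> Rabs (Series a) <= M / (1 - q).
Proof.
  intros Hq H.
  assert (Hg : ex_series (fun k => M * q ^ k)).
  { apply (@ex_series_scal_l R_AbsRing). apply ex_series_geom. rewrite Rabs_pos_eq; lra. }
  assert (Ha : ex_series (fun k => Rabs (a k))).
  { apply (@ex_series_le _ R_CompleteNormedModule _ (fun k => M * q ^ k)); [|exact Hg].
    intros n. unfold norm; simpl. unfold abs; simpl. rewrite Rabs_Rabsolu. apply H. }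
  eapply Rle_trans; [apply Series_Rabs, Ha|].
  eapply Rle_trans; [apply Series_le_gen with (b := fun k => M * q ^ k); assumption|].
  rewrite Series_scal_l, Series_geom by (rewrite Rabs_pos_eq; lra). right; reflexivity.
Qed.

Lemma Series_psum_tail a n : ex_series a ->
  Series a = psum a n + Series (fun k => a (n + k)%nat).
Proof.
  intros H. destruct n as [|n].
  - simpl. rewrite Rplus_0_l. apply Series_ext. reflexivity.
  - rewrite (Series_incr_n a (S n)) by (lia || assumption).
    rewrite <- psum_sum_n, <- sum_n_Reals. reflexivity.
Qed.

Lemma is_lim_seq_psum (a : nat -> nat -> R) (b : nat -> R) N :
  (forall k, is_lim_seq (fun n => a n k) (b k)) ->
  is_lim_seq (fun n => psum (a n) N) (psum b N).
Proof.
  intros H. induction N as [|N IH]; simpl; [apply is_lim_seq_const|].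
  now apply is_lim_seq_plus'.
Qed.

(* Tannery's theorem with a geometric dominating series. *)
Lemma Series_dominated_cv (a : nat -> nat -> R) (b : nat -> R) (M q : R) :
  0 <= q < 1 ->
  (forall k, is_lim_seq (fun n => a n k) (b k)) ->
  eventually (fun n => forall k, Rabs (a n k) <= M * q ^ k) ->
  is_lim_seq (fun n => Series (a n)) (Series b).
Proof.
  intros Hq Hlim [n0 Hdom].
  assert (Hb : forall k, Rabs (b k) <= M * q ^ k).
  { intros k. apply (is_lim_seq_le_loc (fun n => Rabs (a n k)) (fun _ => M * q ^ k)
      (Rabs (b k)) (M * q ^ k)).
    - exists n0. intros n Hn. now apply Hdom.
    - apply (is_lim_seq_abs _ (b k)), Hlim.
    - apply is_lim_seq_const. }
  assert (Htail : forall f, (forall k, Rabs (f k) <= M * q ^ k) -> forall N,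
      Rabs (Series (fun k => f (N + k)%nat)) <= (M / (1 - q)) * q ^ N).
  { intros f Hf N. replace (M / (1 - q) * q ^ N) with ((M * q ^ N) / (1 - q)) by (field; lra).
    apply Series_geom_bound; [exact Hq|]. intros k.
    eapply Rle_trans; [apply Hf|]. rewrite pow_add; right; ring. }
  set (T := M / (1 - q)).
  assert (HT : 0 <= T).
  { apply Rmult_le_pos; [|apply Rlt_le, Rinv_0_lt_compat; lra].
    specialize (Hb 0%nat). simpl in Hb. pose proof (Rabs_pos (b 0%nat)). lra. }
  apply is_lim_seq_spec. intros eps.
  assert (Hpow : is_lim_seq (fun N => T * q ^ N) 0).
  { replace (Finite 0) with (Rbar_mult T 0) by (simpl; f_equal; ring).
    apply (is_lim_seq_scal_l _ T 0). apply is_lim_seq_geom. rewrite Rabs_pos_eq; lra. }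
  apply is_lim_seq_spec in Hpow.
  (* A third of [eps] goes to each of the two tails beyond [N] and a third to the difference of the
     sums of the first [N] terms. *)
  assert (He3 : 0 < eps / 3) by (destruct eps; simpl; lra).
  destruct (Hpow (mkposreal _ He3)) as [N HN]. specialize (HN N (Nat.le_refl _)). simpl in HN.
  rewrite Rminus_0_r in HN. apply Rabs_def2 in HN.
  pose proof (is_lim_seq_psum a b N Hlim) as Hp. apply is_lim_seq_spec in Hp.
  destruct (Hp (mkposreal _ He3)) as [n1 Hn1]. simpl in Hn1.
  exists (Nat.max n0 n1). intros n Hn. simpl.
  specialize (Hn1 n ltac:(lia)). specialize (Hdom n ltac:(lia)).
  rewrite (Series_psum_tail (a n) N) by now apply (ex_series_geom_bound _ M q).
  rewrite (Series_psum_tail b N) by now apply (ex_series_geom_bound _ M q).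
  pose proof (Htail _ Hdom N) as H1. pose proof (Htail _ Hb N) as H2. fold T in H1, H2.
  apply Rabs_def2 in Hn1.
  apply Rabs_le_between in H1. apply Rabs_le_between in H2.
  apply Rabs_def1; lra.
Qed.

(** * The theta inversion formula, after Polya *)

(* [central m] is [binomial(2m, m) / 4^m]. *)
Fixpoint central (m : nat) : R :=
  match m with O => 1 | S p => central p * ((2 * INR p + 1) / (2 * INR p + 2)) end.

(* [bratio m k] is [binomial(2m, m + k) / binomial(2m, m)]; it vanishes for [k > m]. *)
Fixpoint bratio (m k : nat) : R :=
  match k with O => 1 | S p => bratio m p * ((INR m - INR p) / (INR m + INR p + 1)) end.

(** * Fourier expansion of even powers of the cosine *)

Lemma bratio_zero m k : (m < k)%nat -> bratio m k = 0.
Proof.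
  intros H. induction H as [|k H IH]; cbn [bratio].
  - unfold Rdiv. ring.
  - rewrite IH; ring.
Qed.

(** In binomials, [binomial(2m+2, m+k+2)] and [binomial(2m, m+k)] share the factor [(m-k)!], which
    cancels in their quotient. The formula therefore has positive denominators even for [k > m],
    where both sides vanish. *)
Lemma bratio_succ m k :
  bratio (S m) (S k)
  = bratio m k * (INR m + 1) ^ 2 / ((INR m + INR k + 1) * (INR m + INR k + 2)).
Proof.
  pose proof (pos_INR m).
  induction k as [|k IH].
  - cbn [bratio]. rewrite S_INR; simpl (INR 0). field. lra.
  - cbn [bratio]. cbn [bratio] in IH. rewrite IH. rewrite !S_INR.
    pose proof (pos_INR k). field. lra.
Qed.

(** Pascal's rule applied twice to [binomial(2m, m+k) / 4^m]: two more steps of the walk. *)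
Lemma central_bratio_rec m k :
  central (S m) * bratio (S m) (S k)
  = / 4 * (central m * bratio m k + 2 * (central m * bratio m (S k))
           + central m * bratio m (S (S k))).
Proof.
  rewrite bratio_succ. cbn [central bratio]. rewrite S_INR.
  pose proof (pos_INR m). pose proof (pos_INR k). field. lra.
Qed.

Lemma cos_double_sq a : cos a ^ 2 = (1 + cos (2 * a)) / 2.
Proof. rewrite cos_2a_cos; field. Qed.

(* Discrete Green identity for the averaging operator [c k -> (c (k-1) + 2 c k + c (k+1)) / 4]. *)
Lemma averaging_boundary (c c' : nat -> R) (a : R) N :
  c' 0%nat = (c 0%nat + c 1%nat) / 2 ->
  (forall k, c' (S k) = / 4 * (c k + 2 * c (S k) + c (S (S k)))) ->
  c' 0%nat + 2 * psum (fun k => c' (S k) * cos (INR (S k) * a)) N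
  - (1 + cos a) / 2 * (c 0%nat + 2 * psum (fun k => c (S k) * cos (INR (S k) * a)) N)
  = / 2 * (c (S N) * cos (INR N * a) - c N * cos (INR (S N) * a)).
Proof.
  intros H0 HS. induction N as [|N IH].
  - simpl psum. simpl INR. rewrite H0, Rmult_0_l, cos_0, Rmult_1_l. field.
  - cbn [psum]. rewrite HS.
    assert (Hc : cos a * cos (INR (S N) * a)
                 = / 2 * (cos (INR N * a) + cos (INR (S (S N)) * a))).
    { rewrite !S_INR.
      replace (INR N * a) with ((INR N + 1) * a - a) by ring.
      replace ((INR N + 1 + 1) * a) with ((INR N + 1) * a + a) by ring.
      rewrite cos_minus, cos_plus; field. }
    nra.
Qed.

(** Multiplication by [cos a ^ 2 = (1 + cos (2a)) / 2] averages the Fourier coefficients, and the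
    boundary terms at [N] vanish because the coefficients beyond [m] do. Leaving [N] free lets
    [polya_identity] sum over full periods. *)
Lemma cos_pow_expansion m a N : (m <= N)%nat ->
  cos a ^ (2 * m) = central m * bratio m 0 +
    2 * psum (fun k => central m * bratio m (S k) * cos (INR (S k) * (2 * a))) N.
Proof.
  intros HN. induction m as [|m IH].
  - rewrite (psum_ext _ (fun _ => 0)).
    + rewrite psum_0. simpl. ring.
    + intros k _. rewrite (bratio_zero 0) by lia. ring.
  - replace (2 * S m)%nat with (2 + 2 * m)%nat by lia.
    rewrite pow_add, IH, cos_double_sq by lia.
    pose proof (averaging_boundary (fun k => central m * bratio m k)
      (fun k => central (S m) * bratio (S m) k) (2 * a) N) as H.
    cbv beta in H. rewrite (bratio_zero m (S N)) in H by lia.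
    assert (HmN : bratio m N = 0) by (apply bratio_zero; lia). rewrite HmN in H.
    apply Rminus_diag_uniq. rewrite <- (Rminus_0_r (_ - _)).
    match type of H with ?A -> ?B -> _ = ?z =>
      assert (HA : A); [|assert (HB : B); [|specialize (H HA HB)]] end.
    + cbn [central bratio]. simpl (INR 0). pose proof (pos_INR m). field. lra.
    + intros k. apply central_bratio_rec.
    + lra.
Qed.

(** * Orthogonality of characters and path counting on the cycle *)

Lemma dirichlet_kernel n b :
  sin b * (1 + 2 * psum (fun j => cos (INR (S j) * (2 * b))) n) = sin (INR (2 * n + 1) * b).
Proof.
  induction n as [|n IH].
  - simpl. rewrite Rmult_0_r, Rplus_0_r, Rmult_1_r, Rmult_1_l. reflexivity.
  - cbn [psum].
    replace (INR (2 * S n + 1) * b) with (INR (S n) * (2 * b) + b)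
      by (rewrite S_INR, !plus_INR, !mult_INR, !S_INR; simpl; ring).
    replace (INR (2 * n + 1) * b) with (INR (S n) * (2 * b) - b) in IH
      by (rewrite S_INR, !plus_INR, !mult_INR; simpl; ring).
    rewrite sin_plus. rewrite sin_minus in IH. nra.
Qed.

Lemma cos_2PI_INR k : cos (INR k * (2 * PI)) = 1.
Proof.
  replace (INR k * (2 * PI)) with (0 + 2 * INR k * PI) by ring. rewrite cos_period. apply cos_0.
Qed.

(** The trivial case of character orthogonality on [Z/(2n+1)], with opposite frequencies paired into
    cosines: every cosine is 1. *)
Lemma dirichlet_multiple n v :
  1 + 2 * psum (fun j => cos (INR (S j) * (2 * (INR ((2 * n + 1) * v) * PI / INR (2 * n + 1))))) n
  = INR (2 * n + 1).
Proof.
  assert (Hl : INR (2 * n + 1) <> 0) by (apply not_0_INR; lia).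
  rewrite (psum_ext _ (fun j => 1 * 1)).
  - rewrite psum_scal. rewrite plus_INR, mult_INR. simpl (INR 1). simpl (INR 2).
    assert (H : psum (fun _ => 1) n = INR n).
    { clear. induction n as [|n IH]; [reflexivity|]. rewrite S_INR; simpl. now rewrite IH. }
    rewrite H; ring.
  - intros j _. rewrite mult_INR.
    replace (INR (S j) * (2 * (INR (2 * n + 1) * INR v * PI / INR (2 * n + 1))))
      with (INR (S j * v) * (2 * PI)) by (rewrite mult_INR; field; exact Hl).
    rewrite cos_2PI_INR; ring.
Qed.

(** By periodicity the angle reduces to [b = d PI / l]. The Dirichlet kernel then has numerator
    [sin (d PI) = 0], while [0 < d < l] keeps [sin b] positive. *)
Lemma dirichlet_nonmultiple n v d : (0 < d < 2 * n + 1)%nat ->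
  1 + 2 * psum (fun j =>
    cos (INR (S j) * (2 * (INR ((2 * n + 1) * v + d) * PI / INR (2 * n + 1))))) n = 0.
Proof.
  intros Hd.
  set (l := (2 * n + 1)%nat) in *.
  assert (Hl : 0 < INR l) by (apply lt_0_INR; lia).
  set (b := INR d * PI / INR l).
  rewrite (psum_ext _ (fun j => cos (INR (S j) * (2 * b)))).
  - pose proof (dirichlet_kernel n b) as H. fold l in H.
    replace (INR l * b) with (0 + INR d * PI) in H by (unfold b; field; lra).
    assert (Hs : sin (0 + INR d * PI) = 0).
    { apply sin_eq_0_1. exists (Z.of_nat d). rewrite <- INR_IZR_INZ; ring. }
    rewrite Hs in H.
    assert (Hb : 0 < sin b).
    { pose proof PI_RGT_0. assert (0 < INR d) by (apply lt_0_INR; lia).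
      assert (INR d < INR l) by (apply lt_INR; lia).
      apply sin_gt_0; unfold b.
      - apply Rdiv_lt_0_compat; nra.
      - apply Rmult_lt_reg_r with (INR l); [lra|].
        unfold Rdiv; rewrite Rmult_assoc, Rinv_l by lra. nra. }
    apply Rmult_integral in H. destruct H; lra.
  - intros j _. unfold b.
    replace (INR (S j) * (2 * (INR (l * v + d) * PI / INR l)))
      with (INR (S j) * (2 * (INR d * PI / INR l)) + 2 * INR (S j * v) * PI)
      by (rewrite plus_INR, !mult_INR; field; lra).
    apply cos_period.
Qed.

Lemma psum_multiples (f : nat -> R) l V : (0 < l)%nat ->
  (forall v d, (0 < d < l)%nat -> f (l * v + d)%nat = 0) ->
  psum (fun k => f (S k)) (l * V) = psum (fun v => f (l * S v)%nat) V.
Proof.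
  intros Hl Hf. induction V as [|V IH]; [now rewrite Nat.mul_0_r|].
  cbn [psum]. rewrite <- IH.
  replace (l * S V)%nat with (l * V + S (l - 1))%nat by lia.
  rewrite psum_split. cbn [psum].
  rewrite (psum_ext (fun k => f (S (l * V + k))) (fun _ => 0)).
  - rewrite psum_0. replace (S (l * V + (l - 1))) with (l * V + S (l - 1))%nat by lia. ring.
  - intros k Hk. replace (S (l * V + k)) with (l * V + S k)%nat by lia. apply Hf; lia.
Qed.

(* The return probability of the simple random walk on the cycle of length [2n+1], after [2m]
   steps, computed spectrally and by counting paths. *)
Lemma polya_identity n m :
  1 + 2 * psum (fun j => cos (INR (S j) * PI / INR (2 * n + 1)) ^ (2 * m)) n
  = central m * INR (2 * n + 1)
    * (1 + 2 * psum (fun v => bratio m ((2 * n + 1) * S v)) m).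
Proof.
  set (l := (2 * n + 1)%nat).
  assert (Hl : 0 < INR l) by (apply lt_0_INR; lia).
  assert (Hm : (m <= l * m)%nat) by nia.
  set (N := (l * m)%nat) in *.
  (* The character sum at displacement [k]: it is [l] when the path closes up on the cycle and 0
     otherwise. *)
  set (T := fun k => 1 + 2 * psum (fun j => cos (INR (S j) * (2 * (INR k * PI / INR l)))) n).
  (* The leading 1 is the frequency [j = 0], so it is expanded like the other powers of the cosine,
     at the angle 0. *)
  assert (H1 : 1 = central m + 2 * psum (fun k => central m * bratio m (S k)) N).
  { pose proof (cos_pow_expansion m 0 N Hm) as H. rewrite cos_0, pow1 in H. change (bratio m 0) with 1 in H.
    rewrite (psum_ext _ (fun k => central m * bratio m (S k))) in H; [lra|].
    intros k _. rewrite !Rmult_0_r, cos_0; ring. }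
  assert (H2 : psum (fun j => cos (INR (S j) * PI / INR l) ^ (2 * m)) n
    = INR n * central m + 2 * psum (fun k => central m * bratio m (S k) *
        psum (fun j => cos (INR (S j) * (2 * (INR (S k) * PI / INR l)))) n) N).
  { rewrite (psum_ext _ (fun j => central m + 2 * psum (fun k => central m * bratio m (S k) *
      cos (INR (S j) * (2 * (INR (S k) * PI / INR l)))) N)).
    - rewrite psum_plus, psum_scal, psum_switch. f_equal.
      + clear. induction n as [|n IH]; [simpl; ring|]. rewrite S_INR; simpl psum. rewrite IH; ring.
      + f_equal. apply psum_ext. intros k _. apply psum_scal.
    - intros j _. rewrite (cos_pow_expansion m _ N Hm). change (bratio m 0) with 1.
      f_equal; [ring|]. f_equal. apply psum_ext. intros k _. do 2 f_equal. field. lra. }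
  assert (H3 : 1 + 2 * psum (fun j => cos (INR (S j) * PI / INR l) ^ (2 * m)) n
    = central m * (INR l + 2 * psum (fun k => bratio m (S k) * T (S k)) N)).
  { rewrite H2. rewrite H1 at 1. unfold T.
    rewrite (psum_ext (fun k => bratio m (S k) * _) (fun k => bratio m (S k) + 2 * (bratio m (S k) *
        psum (fun j => cos (INR (S j) * (2 * (INR (S k) * PI / INR l)))) n)))
      by (intros; ring).
    rewrite psum_plus, psum_scal.
    rewrite psum_scal.
    rewrite (psum_ext (fun k => central m * bratio m (S k) * _)
      (fun k => central m * (bratio m (S k) * 
        psum (fun j => cos (INR (S j) * (2 * (INR (S k) * PI / INR l)))) n)))
      by (intros; ring).
    rewrite psum_scal. unfold l. rewrite plus_INR, mult_INR. simpl (INR 1). simpl (INR 2). ring. }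
  rewrite H3. unfold N.
  rewrite (psum_multiples (fun k => bratio m k * T k) l m).
  - rewrite (psum_ext _ (fun v => INR l * bratio m (l * S v))).
    + rewrite psum_scal; ring.
    + intros v _. unfold T, l. rewrite dirichlet_multiple. ring.
  - lia.
  - intros v d Hd. unfold T, l. rewrite dirichlet_nonmultiple by exact Hd. ring.
Qed.

(** * Asymptotics of binomial ratios and cosine powers *)

(** [central m ^ 2 * m] increases, while [central m ^ 2 * (2m + 1)] decreases from 1 and so bounds
    it. The Wallis value of the limit is left open here; the inversion formula determines it. *)
Lemma central_sq_cv : exists c : R, is_lim_seq (fun m => central m ^ 2 * INR m) c.
Proof.
  assert (Hb : forall m, central m ^ 2 * (2 * INR m + 1) <= 1).
  { induction m as [|m IH]; [simpl; lra|].
    cbn [central]. rewrite S_INR. pose proof (pos_INR m).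
    apply Rle_trans with (2 := IH).
    assert (H0 : 0 <= central m ^ 2) by apply pow2_ge_0.
    replace ((central m * ((2 * INR m + 1) / (2 * INR m + 2))) ^ 2 * (2 * (INR m + 1) + 1))
      with (central m ^ 2 * ((2 * INR m + 1) ^ 2 * (2 * INR m + 3) / (2 * INR m + 2) ^ 2))
      by (field; lra).
    apply Rmult_le_compat_l; [exact H0|].
    apply Rmult_le_reg_r with ((2 * INR m + 2) ^ 2); [nra|].
    unfold Rdiv; rewrite Rmult_assoc, Rinv_l by nra. nra. }
  apply (ex_finite_lim_seq_incr _ 1).
  - intros m. cbn [central]. rewrite S_INR. pose proof (pos_INR m).
    assert (H0 : 0 <= central m ^ 2) by apply pow2_ge_0.
    replace ((central m * ((2 * INR m + 1) / (2 * INR m + 2))) ^ 2 * (INR m + 1))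
      with (central m ^ 2 * ((2 * INR m + 1) ^ 2 / (4 * (INR m + 1)))) by (field; lra).
    apply Rmult_le_compat_l; [exact H0|].
    apply Rmult_le_reg_r with (4 * (INR m + 1)); [lra|].
    unfold Rdiv; rewrite Rmult_assoc, Rinv_l by nra. nra.
  - intros m. specialize (Hb m). pose proof (pos_INR m). 
    assert (H0 : 0 <= central m ^ 2) by apply pow2_ge_0. nra.
Qed.

Lemma bratio_nonneg m k : 0 <= bratio m k.
Proof.
  induction k as [|k IH]; [simpl; lra|].
  destruct (Nat.le_gt_cases k m) as [H|H].
  - cbn [bratio]. apply Rmult_le_pos; [exact IH|].
    apply le_INR in H. pose proof (pos_INR k).
    apply Rmult_le_pos; [lra|]. apply Rlt_le, Rinv_0_lt_compat; lra.
  - rewrite bratio_zero by lia; lra.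
Qed.

Lemma Rdiv_le_compat_denom a b c : 0 <= a -> 0 < b <= c -> a / c <= a / b.
Proof.
  intros Ha Hb. apply Rmult_le_compat_l; [exact Ha|]. apply Rinv_le_contravar; lra.
Qed.

(** Each factor is [1 - (2j+1)/(m+j+1) <= exp (- (2j+1)/(m+k))] for [j < k], and the first [k] odd
    numbers add up to [k^2]. *)
Lemma bratio_upper m k : (0 < k)%nat -> bratio m k <= exp (- (INR k ^ 2 / (INR m + INR k))).
Proof.
  intros Hk0. pose proof (pos_INR m) as Hm. apply lt_0_INR in Hk0.
  assert (H : forall j, (j <= k)%nat -> bratio m j <= exp (- (INR j ^ 2 / (INR m + INR k)))).
  { induction j as [|j IH]; intros Hj.
    - simpl. unfold Rdiv. rewrite Rmult_0_l, Rmult_0_l, Ropp_0, exp_0; lra.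
    - specialize (IH ltac:(lia)). apply le_INR in Hj. rewrite S_INR in Hj.
      cbn [bratio]. rewrite S_INR. pose proof (pos_INR j).
      replace (- ((INR j + 1) ^ 2 / (INR m + INR k)))
        with (- (INR j ^ 2 / (INR m + INR k)) + - ((2 * INR j + 1) / (INR m + INR k)))
        by (field; lra).
      rewrite exp_plus.
      apply Rle_trans with (bratio m j * exp (- ((2 * INR j + 1) / (INR m + INR k)))).
      + apply Rmult_le_compat_l; [apply bratio_nonneg|].
        eapply Rle_trans; [|apply exp_ineq1_le].
        replace ((INR m - INR j) / (INR m + INR j + 1))
          with (1 - (2 * INR j + 1) / (INR m + INR j + 1)) by (field; lra).
        assert ((2 * INR j + 1) / (INR m + INR k) <= (2 * INR j + 1) / (INR m + INR j + 1))
          by (apply Rdiv_le_compat_denom; lra). lra.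
      + apply Rmult_le_compat_r; [apply Rlt_le, exp_pos|exact IH]. }
  apply H; lia.
Qed.

(** The same sum of odd numbers, applied to the reciprocal factors
    [1 + (2j+1)/(m-j) <= exp ((2j+1)/(m-k))]. *)
Lemma bratio_lower m k : (k < m)%nat -> exp (- (INR k ^ 2 / (INR m - INR k))) <= bratio m k.
Proof.
  intros Hk. apply lt_INR in Hk. pose proof (pos_INR k) as Hk0.
  assert (H : forall j, (j <= k)%nat -> exp (- (INR j ^ 2 / (INR m - INR k))) <= bratio m j).
  { induction j as [|j IH]; intros Hj.
    - simpl. unfold Rdiv. rewrite Rmult_0_l, Rmult_0_l, Ropp_0, exp_0; lra.
    - specialize (IH ltac:(lia)). apply le_INR in Hj. rewrite S_INR in Hj.
      cbn [bratio]. rewrite S_INR. pose proof (pos_INR j).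
      replace (- ((INR j + 1) ^ 2 / (INR m - INR k)))
        with (- (INR j ^ 2 / (INR m - INR k)) + - ((2 * INR j + 1) / (INR m - INR k)))
        by (field; lra).
      rewrite exp_plus.
      apply Rmult_le_compat; try apply Rlt_le, exp_pos; [exact IH|].
      rewrite exp_Ropp.
      replace ((INR m - INR j) / (INR m + INR j + 1))
        with (/ (1 + (2 * INR j + 1) / (INR m - INR j))) by (field; lra).
      apply Rinv_le_contravar.
      + assert (0 <= (2 * INR j + 1) / (INR m - INR j)); [|lra].
        apply Rmult_le_pos; [lra|]. apply Rlt_le, Rinv_0_lt_compat; lra.
      + eapply Rle_trans; [|apply exp_ineq1_le]. apply Rplus_le_compat_l.
        apply Rdiv_le_compat_denom; lra. }
  apply H; lia.
Qed.

Lemma exp_opp_unit x : 0 < x -> 0 <= exp (- x) < 1.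
Proof.
  intros Hx. split; [apply Rlt_le, exp_pos|]. rewrite <- exp_0. apply exp_increasing; lra.
Qed.

Lemma exp_mult_INR y m : exp y ^ m = exp (INR m * y).
Proof.
  induction m as [|m IH]; [simpl; now rewrite Rmult_0_l, exp_0|].
  rewrite S_INR, Rmult_plus_distr_r, exp_plus, <- IH. simpl. rewrite Rmult_1_l; ring.
Qed.

(** From [cos^2 = 1 - sin^2 <= exp (- sin^2)]. *)
Lemma cos_pow_upper x m : cos x ^ (2 * m) <= exp (- (INR m * sin x ^ 2)).
Proof.
  replace (- (INR m * sin x ^ 2)) with (INR m * - sin x ^ 2) by ring.
  rewrite pow_mult, <- exp_mult_INR. apply pow_incr. split; [apply pow2_ge_0|].
  eapply Rle_trans; [|apply exp_ineq1_le].
  pose proof (sin2_cos2 x) as H. unfold Rsqr in H. nra.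
Qed.

(** From [1 / cos^2 = 1 + tan^2 <= exp (tan^2)]. *)
Lemma cos_pow_lower x m : cos x <> 0 ->
  exp (- (INR m * sin x ^ 2 / cos x ^ 2)) <= cos x ^ (2 * m).
Proof.
  intros Hc. assert (Hc2 : 0 < cos x ^ 2) by (apply pow2_gt_0; exact Hc).
  replace (- (INR m * sin x ^ 2 / cos x ^ 2)) with (INR m * - (sin x ^ 2 / cos x ^ 2))
    by (field; exact Hc).
  rewrite pow_mult, <- exp_mult_INR. apply pow_incr. split; [apply Rlt_le, exp_pos|].
  rewrite exp_Ropp, <- (Rinv_inv (cos x ^ 2)). apply Rinv_le_contravar.
  - now apply Rinv_0_lt_compat.
  - eapply Rle_trans; [|apply exp_ineq1_le]. right.
    pose proof (sin2_cos2 x) as H. unfold Rsqr in H.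
    replace (sin x ^ 2) with (1 - cos x ^ 2) by (simpl; lra). field. exact Hc.
Qed.

(** [sin x >= x - x^3/6], which exceeds [x/3] by [x (4 - x^2) / 6], and [x <= PI/2 <= 2]. The slope
    [1/3] is convenient since [PI/3 >= 1] in the domination below. *)
Lemma sin_ge_third x : 0 <= x <= PI / 2 -> x / 3 <= sin x.
Proof.
  intros Hx. pose proof PI_4. pose proof PI_RGT_0.
  pose proof (sin_bound x 0 ltac:(lra) ltac:(lra)) as [H1 _].
  eapply Rle_trans; [|exact H1].
  unfold sin_approx, sin_term. simpl. 
  assert (0 <= x * (4 - x * x)) by (apply Rmult_le_pos; nra). lra.
Qed.

Lemma is_lim_seq_exp_opp (u : nat -> R) (x : R) :
  is_lim_seq u x -> is_lim_seq (fun n => exp (- u n)) (exp (- x)).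
Proof.
  intros H. apply (is_lim_seq_continuous exp); [apply derivable_continuous, derivable_exp|].
  exact (proj1 (is_lim_seq_opp _ _) H).
Qed.

(** [theta3] folded onto the positive integers, free of the choice operator in [sumZ]. *)
Definition jacobi (s : R) : R := 1 + 2 * Series (fun k => exp (- (PI * INR (S k) ^ 2 * s))).

Lemma jacobi_ge_1 s : 0 < s -> 1 <= jacobi s.
Proof.
  intros Hs. unfold jacobi.
  assert (0 <= Series (fun k => exp (- (PI * INR (S k) ^ 2 * s)))); [|lra].
  apply Series_nonneg; [intros; apply Rlt_le, exp_pos|].
  apply (ex_series_geom_bound _ 1 (exp (- s))).
  - apply exp_opp_unit; lra.
  - intros k. rewrite Rabs_pos_eq by apply Rlt_le, exp_pos.
    rewrite Rmult_1_l, exp_mult_INR.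
    assert (H : INR k * s <= PI * INR (S k) ^ 2 * s).
    { apply Rmult_le_compat_r; [lra|]. rewrite S_INR. pose proof (pos_INR k).
      pose proof PI2_3_2. nra. }
    destruct H as [H|H]; [apply Rlt_le, exp_increasing; lra|right; f_equal; lra].
Qed.

Lemma exp_le_compat x y : x <= y -> exp x <= exp y.
Proof. intros [H|H]; [now apply Rlt_le, exp_increasing|now right; rewrite H]. Qed.

(** * Diffusive limit of the identity on the cycle *)

Section PolyaLimit.

(** Diffusive scaling: a cycle of length [l = 2n+1] and [m = floor (tau l^2)] double steps. *)
Variables (tau : R) (l : nat -> R) (m : nat -> nat).
Hypothesis Htau : 0 < tau.
Hypothesis l_def : forall n, l n = INR (2 * n + 1).
Hypothesis m_spec : forall n, INR (m n) <= tau * l n ^ 2 < INR (m n) + 1.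

Lemma l_ge n : INR n + 1 <= l n.
Proof. rewrite l_def, plus_INR, mult_INR. simpl. pose proof (pos_INR n). lra. Qed.

Lemma l_ge_1 n : 1 <= l n.
Proof. pose proof (l_ge n). pose proof (pos_INR n). lra. Qed.

Lemma inv_l_cv : is_lim_seq (fun n => / l n) 0.
Proof.
  apply (is_lim_seq_inv _ p_infty); [|discriminate].
  apply is_lim_seq_le_p_loc with INR; [|apply is_lim_seq_INR].
  exists 0%nat. intros n _. pose proof (l_ge n). lra.
Qed.

Lemma ratio_cv : is_lim_seq (fun n => INR (m n) / l n ^ 2) tau.
Proof.
  apply is_lim_seq_le_le with (fun n => tau - / l n * / l n) (fun _ => tau).
  - intros n. pose proof (l_ge_1 n). pose proof (m_spec n) as Hm.
    assert (Hl : 0 < l n ^ 2) by nra.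
    split; apply Rmult_le_reg_r with (l n ^ 2); try lra.
    + replace ((tau - / l n * / l n) * l n ^ 2) with (tau * l n ^ 2 - 1) by (field; lra).
      unfold Rdiv; rewrite Rmult_assoc, Rinv_l by lra. lra.
    + unfold Rdiv; rewrite Rmult_assoc, Rinv_l by lra. lra.
  - replace (Finite tau) with (Finite (tau - 0 * 0)) by (f_equal; ring).
    apply is_lim_seq_minus'; [apply is_lim_seq_const|].
    apply is_lim_seq_mult'; exact inv_l_cv.
  - apply is_lim_seq_const.
Qed.

Lemma ratio_eventually : eventually (fun n => tau / 2 <= INR (m n) / l n ^ 2).
Proof.
  assert (He : 0 < tau / 2) by lra.
  pose proof ratio_cv as H. apply is_lim_seq_spec in H. destruct (H (mkposreal _ He)) as [N HN].
  exists N. intros n Hn. specialize (HN n Hn). cbn [pos] in HN. apply Rabs_def2 in HN. lra.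
Qed.

Lemma ratio_le n : INR (m n) / l n ^ 2 <= tau.
Proof.
  pose proof (l_ge_1 n). pose proof (m_spec n). assert (0 < l n ^ 2) by nra.
  apply Rmult_le_reg_r with (l n ^ 2); [lra|].
  unfold Rdiv; rewrite Rmult_assoc, Rinv_l by lra. lra.
Qed.

Lemma m_cv_infty : is_lim_seq (fun n => INR (m n)) p_infty.
Proof.
  apply is_lim_seq_le_p_loc with (fun n => tau / 2 * INR n).
  - destruct ratio_eventually as [N HN]. exists N. intros n Hn. specialize (HN n Hn).
    pose proof (l_ge_1 n). pose proof (l_ge n). pose proof (pos_INR n).
    assert (Hl : 0 < l n ^ 2) by nra.
    assert (H2 : tau / 2 * l n ^ 2 <= INR (m n)).
    { apply Rmult_le_compat_r with (r := l n ^ 2) in HN; [|lra].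
      unfold Rdiv in HN at 2. rewrite Rmult_assoc, Rinv_l in HN by lra. lra. }
    assert (INR n <= l n ^ 2) by nra. nra.
  - pose proof (is_lim_seq_scal_l _ (tau / 2) p_infty is_lim_seq_INR) as H.
    simpl in H. destruct (Rle_dec 0 (tau / 2)) as [h|h]; [|lra].
    destruct (Rle_lt_or_eq_dec 0 (tau / 2) h); [exact H|lra].
Qed.

(** With [m ~ tau l^2], the power [cos (u PI / l) ^ (2m)] behaves like [exp (- m sin^2)] and tends
    to [exp (- tau (u PI)^2)]. *)
Lemma spectral_cv :
  is_lim_seq (fun n => 1 + 2 * psum (fun j => cos (INR (S j) * PI / l n) ^ (2 * m n)) n)
    (jacobi (PI * tau)).
Proof.
  pose proof PI_RGT_0 as HPI.
  (* Extension by 0 beyond [n] turns the finite sums into series, to which dominated convergence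
     applies. *)
  set (a := fun n k => if Nat.ltb k n then cos (INR (S k) * PI / l n) ^ (2 * m n) else 0).
  apply is_lim_seq_ext with (fun n => 1 + 2 * Series (a n)).
  { intros n. do 2 f_equal.
    rewrite (is_series_unique _ _ (is_series_finite (a n) n
      ltac:(intros k Hk; unfold a; apply Nat.ltb_ge in Hk; now rewrite Hk))).
    apply psum_ext. intros k Hk. unfold a. apply Nat.ltb_lt in Hk. now rewrite Hk. }
  unfold jacobi. apply is_lim_seq_plus'; [apply is_lim_seq_const|].
  apply (is_lim_seq_scal_l _ 2 (Finite _)).
  (* The ratio comes from [m / l^2 >= tau / 2] together with [sin x >= x / 3] and [PI / 3 >= 1]; for
     [k < n] the angle stays below [PI / 2]. *)
  apply (Series_dominated_cv a _ 1 (exp (- (tau / 2)))).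
  - apply exp_opp_unit; lra.
  - intros k. set (u := INR (S k)).
    assert (Hu : 1 <= u) by (unfold u; rewrite S_INR; pose proof (pos_INR k); lra).
    assert (Hx : is_lim_seq (fun n => u * PI / l n) 0).
    { replace (Finite 0) with (Finite (u * PI * 0)) by (f_equal; ring).
      apply is_lim_seq_mult'; [apply is_lim_seq_const|exact inv_l_cv]. }
    assert (Hsin : is_lim_seq (fun n => INR (m n) * sin (u * PI / l n) ^ 2)
                     (tau * (u * PI) ^ 2)).
    { assert (Hsc : is_lim_seq (fun n => sin (u * PI / l n) / (u * PI / l n)) 1).
      { apply (is_lim_comp_seq (fun x => sin x / x) _ 0); [apply is_lim_sinc_0| |exact Hx].
        exists 0%nat. intros n _ H. pose proof (l_ge_1 n). injection H.
        apply Rgt_not_eq, Rdiv_lt_0_compat; nra. }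
      apply is_lim_seq_ext with (fun n => INR (m n) / l n ^ 2 * ((u * PI) ^ 2 *
        (sin (u * PI / l n) / (u * PI / l n) * (sin (u * PI / l n) / (u * PI / l n))))).
      { intros n. pose proof (l_ge_1 n). field. repeat split; nra. }
      replace (tau * (u * PI) ^ 2) with (tau * ((u * PI) ^ 2 * (1 * 1))) by ring.
      apply is_lim_seq_mult'; [exact ratio_cv|]. apply is_lim_seq_mult'; [apply is_lim_seq_const|].
      now apply is_lim_seq_mult'. }
    assert (Hcos : is_lim_seq (fun n => cos (u * PI / l n)) 1).
    { rewrite <- cos_0. apply is_lim_seq_continuous; [apply continuity_cos|exact Hx]. }
    apply is_lim_seq_le_le_loc with
      (fun n => exp (- (INR (m n) * sin (u * PI / l n) ^ 2 / cos (u * PI / l n) ^ 2)))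
      (fun n => exp (- (INR (m n) * sin (u * PI / l n) ^ 2))).
    + apply is_lim_seq_spec in Hcos. destruct (Hcos (mkposreal 1 Rlt_0_1)) as [N HN].
      exists (Nat.max N (S k)). intros n Hn. unfold a.
      replace (Nat.ltb k n) with true by (symmetry; apply Nat.ltb_lt; lia).
      fold u. specialize (HN n ltac:(lia)). cbn [pos] in HN. apply Rabs_def2 in HN.
      split; [apply cos_pow_lower; lra|apply cos_pow_upper].
    + replace (PI * u ^ 2 * (PI * tau)) with (tau * (u * PI) ^ 2 / (1 * 1)) by (field).
      apply is_lim_seq_exp_opp. apply is_lim_seq_div'; [exact Hsin| |lra].
      apply is_lim_seq_ext with (fun n => cos (u * PI / l n) * cos (u * PI / l n));
        [intros; simpl; ring|]. now apply is_lim_seq_mult'.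
    + replace (PI * u ^ 2 * (PI * tau)) with (tau * (u * PI) ^ 2) by ring.
      apply is_lim_seq_exp_opp. exact Hsin.
  - destruct ratio_eventually as [N HN]. exists N. intros n Hn k. specialize (HN n Hn).
    rewrite Rmult_1_l, exp_mult_INR. unfold a.
    destruct (Nat.ltb_spec k n) as [Hk|Hk].
    2: { rewrite Rabs_R0. apply Rlt_le, exp_pos. }
    set (u := INR (S k)).
    assert (Hu : u = INR k + 1) by apply S_INR. pose proof (pos_INR k) as Hk0.
    pose proof (l_ge_1 n) as Hl.
    rewrite Rabs_pos_eq by (rewrite pow_mult; apply pow_le, pow2_ge_0).
    eapply Rle_trans; [apply cos_pow_upper|]. apply exp_le_compat.
    assert (Hx : u * PI / l n / 3 <= sin (u * PI / l n)).
    { apply sin_ge_third. split; [apply Rlt_le, Rdiv_lt_0_compat; nra|].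
      apply Rmult_le_reg_r with (l n); [lra|].
      unfold Rdiv at 1; rewrite Rmult_assoc, Rinv_l by lra.
      assert (2 * u <= l n).
      { rewrite l_def; unfold u. replace 2 with (INR 2) by reflexivity. rewrite <- mult_INR.
        apply le_INR. lia. } nra. }
    assert (Hx0 : 0 <= u * PI / l n / 3).
    { apply Rlt_le, Rdiv_lt_0_compat; [apply Rdiv_lt_0_compat; nra|lra]. }
    assert (Hs2 : (u * PI / l n / 3) ^ 2 <= sin (u * PI / l n) ^ 2) by (apply pow_incr; lra).
    assert (INR k * (tau / 2) <= INR (m n) * (u * PI / l n / 3) ^ 2).
    { replace (INR (m n) * (u * PI / l n / 3) ^ 2)
        with (INR (m n) / l n ^ 2 * (u ^ 2 * (PI / 3) ^ 2)) by (field; lra).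
      rewrite (Rmult_comm (INR k)). apply Rmult_le_compat; try lra.
      pose proof PI2_3_2.
      assert (1 <= (PI / 3) ^ 2) by nra. assert (INR k <= u ^ 2) by nra. nra. }
    pose proof (pos_INR (m n)). nra.
Qed.

(** Gaussian limit of the binomial ratios: [bratio m (l u)] is close to [exp (- (l u)^2 / m)], which
    tends to [exp (- u^2 / tau)]. *)
Lemma path_cv :
  is_lim_seq (fun n => 1 + 2 * psum (fun v => bratio (m n) ((2 * n + 1) * S v)) (m n))
    (jacobi (/ (PI * tau))).
Proof.
  pose proof PI_RGT_0 as HPI.
  set (a := fun n v => bratio (m n) ((2 * n + 1) * S v)).
  apply is_lim_seq_ext with (fun n => 1 + 2 * Series (a n)).
  { intros n. do 2 f_equal. apply is_series_unique, is_series_finite.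
    intros k Hk. apply bratio_zero. nia. }
  unfold jacobi. apply is_lim_seq_plus'; [apply is_lim_seq_const|].
  apply (is_lim_seq_scal_l _ 2 (Finite _)).
  (* The ratio comes from [m + l u <= (tau + 1) l^2 u], valid as [l] and [u] are at least 1,
     inserted in [bratio_upper]. *)
  apply (Series_dominated_cv a _ 1 (exp (- (/ (tau + 1))))).
  - assert (0 < / (tau + 1)) by (apply Rinv_0_lt_compat; lra).
    apply exp_opp_unit; lra.
  - intros k. set (u := INR (S k)).
    assert (Hu : 1 <= u) by (unfold u; rewrite S_INR; pose proof (pos_INR k); lra).
    assert (Hul : is_lim_seq (fun n => u * / l n) 0).
    { replace (Finite 0) with (Finite (u * 0)) by (f_equal; ring).
      apply is_lim_seq_mult'; [apply is_lim_seq_const|exact inv_l_cv]. }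
    (* This says [l u < m], the range where [bratio_lower] applies. *)
    assert (Hlarge : eventually (fun n => u * / l n < INR (m n) / l n ^ 2)).
    { apply is_lim_seq_spec in Hul. assert (He : 0 < tau / 2) by lra.
      destruct (Hul (mkposreal _ He)) as [N1 H1]. destruct ratio_eventually as [N2 H2].
      exists (Nat.max N1 N2). intros n Hn. specialize (H1 n ltac:(lia)).
      specialize (H2 n ltac:(lia)). cbn [pos] in H1. apply Rabs_def2 in H1. lra. }
    replace (PI * u ^ 2 * / (PI * tau)) with (u ^ 2 / tau) by (field; lra).
    apply is_lim_seq_le_le_loc with
      (fun n => exp (- (u ^ 2 / (INR (m n) / l n ^ 2 - u * / l n))))
      (fun n => exp (- (u ^ 2 / (INR (m n) / l n ^ 2 + u * / l n)))).
    + destruct Hlarge as [N HN]. exists N. intros n Hn. specialize (HN n Hn). unfold a.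
      pose proof (l_ge_1 n) as Hl.
      assert (Hk : INR ((2 * n + 1) * S k) = l n * u) by (rewrite mult_INR, l_def; reflexivity).
      assert (Hlt : l n * u < INR (m n)).
      { apply Rmult_lt_compat_r with (r := l n ^ 2) in HN; [|nra].
        replace (u * / l n * l n ^ 2) with (l n * u) in HN by (field; lra).
        replace (INR (m n) / l n ^ 2 * l n ^ 2) with (INR (m n)) in HN by (field; lra).
        exact HN. }
      split.
      * replace (u ^ 2 / (INR (m n) / l n ^ 2 - u * / l n))
          with ((l n * u) ^ 2 / (INR (m n) - l n * u)).
        -- rewrite <- Hk. apply bratio_lower. apply INR_lt. lra.
        -- field. repeat split; lra.
      * replace (u ^ 2 / (INR (m n) / l n ^ 2 + u * / l n))
          with ((l n * u) ^ 2 / (INR (m n) + l n * u)).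
        -- rewrite <- Hk. apply bratio_upper. lia.
        -- pose proof (pos_INR (m n)). field. repeat split; nra.
    + apply is_lim_seq_exp_opp. apply is_lim_seq_div'; [apply is_lim_seq_const| |lra].
      replace (Finite tau) with (Finite (tau - 0)) by (f_equal; ring).
      apply is_lim_seq_minus'; [exact ratio_cv|exact Hul].
    + apply is_lim_seq_exp_opp. apply is_lim_seq_div'; [apply is_lim_seq_const| |lra].
      replace (Finite tau) with (Finite (tau + 0)) by (f_equal; ring).
      apply is_lim_seq_plus'; [exact ratio_cv|exact Hul].
  - exists 0%nat. intros n _ k. unfold a.
    rewrite Rmult_1_l, exp_mult_INR, Rabs_pos_eq by apply bratio_nonneg.
    eapply Rle_trans; [apply bratio_upper; lia|]. apply exp_le_compat.
    set (u := INR (S k)).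
    assert (Hu : u = INR k + 1) by apply S_INR. pose proof (pos_INR k) as Hk0.
    pose proof (l_ge_1 n) as Hl. pose proof (ratio_le n) as Hr. pose proof (pos_INR (m n)) as Hm.
    replace (INR ((2 * n + 1) * S k)) with (l n * u) by (rewrite mult_INR, l_def; reflexivity).
    assert (H1 : (l n * u) ^ 2 / (l n ^ 2 * (tau + 1) * u) <= (l n * u) ^ 2 / (INR (m n) + l n * u)).
    { apply Rdiv_le_compat_denom; [apply pow2_ge_0|]. pose proof (m_spec n).
      assert (0 < l n * u) by nra. split; [lra|].
      assert (l n * u <= l n ^ 2 * u) by nra.
      assert (tau * l n ^ 2 <= tau * l n ^ 2 * u); [|lra].
      assert (0 <= tau * l n ^ 2) by nra. nra. }
    replace ((l n * u) ^ 2 / (l n ^ 2 * (tau + 1) * u)) with (u * / (tau + 1)) in H1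
      by (field; repeat split; lra).
    assert (0 < / (tau + 1)) by (apply Rinv_0_lt_compat; lra). nra.
Qed.

(** Squaring [A n = central m * l * B n] turns the prefactor into [(central m ^ 2 * m) / (m / l^2)],
    whose limit is [c / tau]. *)
Lemma jacobi_sq_polya (c : R) :
  is_lim_seq (fun m => central m ^ 2 * INR m) c ->
  jacobi (PI * tau) ^ 2 = c / tau * jacobi (/ (PI * tau)) ^ 2.
Proof.
  intros Hc.
  set (A := fun n => 1 + 2 * psum (fun j => cos (INR (S j) * PI / l n) ^ (2 * m n)) n).
  set (B := fun n => 1 + 2 * psum (fun v => bratio (m n) ((2 * n + 1) * S v)) (m n)).
  assert (HL : is_lim_seq (fun n => A n * A n) (jacobi (PI * tau) * jacobi (PI * tau)))
    by (apply is_lim_seq_mult'; apply spectral_cv).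
  assert (HR : is_lim_seq (fun n => central (m n) ^ 2 * INR (m n) / (INR (m n) / l n ^ 2) *
     (B n * B n)) (c / tau * (jacobi (/ (PI * tau)) * jacobi (/ (PI * tau))))).
  { apply is_lim_seq_mult'; [|apply is_lim_seq_mult'; apply path_cv].
    apply is_lim_seq_div'; [|exact ratio_cv|lra].
    apply (is_lim_seq_subseq (fun m => central m ^ 2 * INR m)); [|exact Hc].
    intros P [N HN]. pose proof m_cv_infty as Hm. apply is_lim_seq_spec in Hm.
    destruct (Hm (INR N)) as [n0 Hn0]. exists n0. intros n Hn. apply HN.
    apply INR_le, Rlt_le. now apply Hn0. }
  assert (HRL : is_lim_seq (fun n => A n * A n)
     (c / tau * (jacobi (/ (PI * tau)) * jacobi (/ (PI * tau))))).
  { eapply is_lim_seq_ext_loc; [|exact HR].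
    pose proof m_cv_infty as Hm. apply is_lim_seq_spec in Hm.
    destruct (Hm 0) as [n0 Hn0]. exists n0. intros n Hn. specialize (Hn0 n Hn).
    assert (HA : A n = central (m n) * l n * B n).
    { unfold A, B. rewrite l_def. apply polya_identity. }
    rewrite HA. pose proof (l_ge_1 n). field. lra. }
  apply is_lim_seq_unique in HL. apply is_lim_seq_unique in HRL.
  rewrite HL in HRL. injection HRL as H. simpl. rewrite !Rmult_1_r. exact H.
Qed.

End PolyaLimit.

Theorem jacobi_inversion s : 0 < s -> jacobi (/ s) = sqrt s * jacobi s.
Proof.
  intros Hs. pose proof PI_RGT_0 as HPI. destruct central_sq_cv as [c Hc].
  assert (key : forall t, 0 < t -> jacobi t ^ 2 = c * PI / t * jacobi (/ t) ^ 2).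
  { intros t Ht. assert (Htau : 0 < t / PI) by (apply Rdiv_lt_0_compat; lra).
    pose (l := fun n => INR (2 * n + 1)).
    assert (Hl : forall n, 0 <= t / PI * l n ^ 2)
      by (intros n; apply Rmult_le_pos; [lra|apply pow2_ge_0]).
    pose (m := fun n => proj1_sig (nfloor_ex _ (Hl n))).
    pose proof (jacobi_sq_polya (t / PI) l m Htau (fun n => eq_refl)
      (fun n => proj2_sig (nfloor_ex _ (Hl n))) c Hc) as H.
    replace (PI * (t / PI)) with t in H by (field; lra).
    rewrite H. field. lra. }
  pose proof (key 1 Rlt_0_1) as H1. rewrite Rinv_1 in H1.
  pose proof (jacobi_ge_1 1 Rlt_0_1) as Hj.
  (* At [t = 1] both sides carry the same factor [jacobi 1 ^ 2], which is nonzero. *)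
  assert (HcPI : c * PI = 1).
  { apply Rmult_eq_reg_r with (jacobi 1 ^ 2); [|apply pow_nonzero; lra].
    rewrite Rmult_1_l. symmetry. rewrite H1 at 1. field. }
  specialize (key s Hs). rewrite HcPI in key.
  assert (Hi : 0 < / s) by now apply Rinv_0_lt_compat.
  pose proof (jacobi_ge_1 s Hs). pose proof (jacobi_ge_1 _ Hi).
  pose proof (sqrt_pos s). apply Rsqr_inj; [lra|nra|].
  rewrite Rsqr_mult, Rsqr_sqrt by lra. unfold Rsqr.
  replace (jacobi s * jacobi s) with (jacobi s ^ 2) by ring. rewrite key. field. lra.
Qed.

(** * From bilateral sums to one-sided series *)

Lemma sumZ_partial_S f N :
  sumZ_partial f (S N) = sumZ_partial f N + (f (Z.of_nat (S N)) + f (- Z.of_nat (S N))%Z).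
Proof.
  unfold sumZ_partial. replace (2 * S N)%nat with (S (S (2 * N))) by lia.
  rewrite tech5, decomp_sum by lia. cbn [Nat.pred].
  rewrite (sum_eq _ (fun i => f (Z.of_nat i - Z.of_nat N)%Z)).
  - replace (Z.of_nat (S (S (2 * N))) - Z.of_nat (S N))%Z with (Z.of_nat (S N)) by lia.
    replace (Z.of_nat 0 - Z.of_nat (S N))%Z with (- Z.of_nat (S N))%Z by lia. ring.
  - intros i _. f_equal. lia.
Qed.

Lemma sumZ_partial_psum f N :
  sumZ_partial f N = f 0%Z + psum (fun k => f (Z.of_nat (S k)) + f (- Z.of_nat (S k))%Z) N.
Proof.
  induction N as [|N IH].
  - unfold sumZ_partial. simpl. ring.
  - rewrite sumZ_partial_S, IH. cbn [psum]. ring.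
Qed.

(** Once a limit exists, [epsilon] returns a limit, and limits are unique. *)
Lemma sumZ_unique f l : sumZ_cv f l -> sumZ f = l.
Proof.
  intros H. apply (UL_sequence (sumZ_partial f)); [|exact H].
  exact (epsilon_spec (inhabits 0) (fun l => sumZ_cv f l) (ex_intro _ l H)).
Qed.

Lemma sumZ_series f : ex_series (fun k => f (Z.of_nat (S k)) + f (- Z.of_nat (S k))%Z) ->
  sumZ f = f 0%Z + Series (fun k => f (Z.of_nat (S k)) + f (- Z.of_nat (S k))%Z).
Proof.
  intros H. apply sumZ_unique. unfold sumZ_cv. apply is_lim_seq_Reals.
  apply is_lim_seq_ext with
    (fun N => f 0%Z + psum (fun k => f (Z.of_nat (S k)) + f (- Z.of_nat (S k))%Z) N).
  - intros N. now rewrite sumZ_partial_psum.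
  - apply is_lim_seq_plus'; [apply is_lim_seq_const|].
    apply is_series_psum. now apply Series_correct.
Qed.

Lemma Series_even_odd f : ex_series f ->
  ex_series (fun k => f (2 * k)%nat) -> ex_series (fun k => f (2 * k + 1)%nat) ->
  Series f = Series (fun k => f (2 * k)%nat) + Series (fun k => f (2 * k + 1)%nat).
Proof.
  intros Hf H0 H1.
  assert (Hp : forall n, psum f (2 * n)
    = psum (fun k => f (2 * k)%nat) n + psum (fun k => f (2 * k + 1)%nat) n).
  { induction n as [|n IH]; [simpl; ring|].
    replace (2 * S n)%nat with (S (S (2 * n))) by lia. cbn [psum]. rewrite IH.
    replace (S (2 * n)) with (2 * n + 1)%nat by lia. ring. }
  apply Series_correct, is_series_psum in Hf. apply Series_correct, is_series_psum in H0.
  apply Series_correct, is_series_psum in H1.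
  assert (HL : is_lim_seq (fun n => psum f (2 * n)) (Series f)).
  { apply (is_lim_seq_subseq (psum f)); [|exact Hf]. apply eventually_subseq. intros; lia. }
  pose proof (is_lim_seq_plus' _ _ _ _ H0 H1) as HR.
  apply (is_lim_seq_ext _ (fun n => psum f (2 * n))) in HR; [|intros; now rewrite Hp].
  apply is_lim_seq_unique in HL. apply is_lim_seq_unique in HR. rewrite HL in HR.
  now injection HR.
Qed.

(** * Exponential sums and the even and odd parts of [theta3] *)

Definition expsum (c : nat -> R) (t : R) : R := Series (fun k => exp (- (c k * t))).
(** Minus the termwise derivative of [expsum]. *)
Definition expsum1 (c : nat -> R) (t : R) : R := Series (fun k => c k * exp (- (c k * t))).

Lemma mul_exp_opp_le x : x * exp (- x) <= 1.
Proof.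
  rewrite exp_Ropp. pose proof (exp_pos x). apply Rmult_le_reg_r with (exp x); [lra|].
  rewrite Rmult_assoc, Rinv_l by lra. pose proof (exp_ineq1_le x). lra.
Qed.

Lemma exp_opp_le_geom c t k : 0 < t -> INR k + 1 <= c -> exp (- (c * t)) <= exp (- t) ^ S k.
Proof.
  intros Ht Hc. rewrite exp_mult_INR. apply exp_le_compat. rewrite S_INR.
  pose proof (pos_INR k). nra.
Qed.

(** Serves termwise differentiation: quadratic remainder bounds on the terms can simply be
    summed. *)
Lemma is_derive_quadratic_remainder (f : R -> R) (t l K d : R) :
  0 < d -> (forall h, Rabs h < d -> Rabs (f (t + h) - f t - h * l) <= K * h ^ 2) ->
  is_derive f t l.
Proof.
  intros Hd H. apply is_derive_Reals. intros eps Heps.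
  (* The maximum makes the constant positive whatever the sign of [K], so that division by it is
     safe. *)
  set (K' := Rmax K 1). assert (HK : 0 < K') by (pose proof (Rmax_r K 1); unfold K'; lra).
  assert (He : 0 < Rmin d (eps / K')) by (apply Rmin_pos; [lra|apply Rdiv_lt_0_compat; lra]).
  exists (mkposreal _ He). intros h Hh0 Hh. cbn [pos] in Hh.
  pose proof (Rmin_l d (eps / K')). pose proof (Rmin_r d (eps / K')).
  specialize (H h ltac:(lra)).
  replace ((f (t + h) - f t) / h - l) with ((f (t + h) - f t - h * l) / h) by (field; assumption).
  assert (Hh1 : 0 < Rabs h) by now apply Rabs_pos_lt.
  unfold Rdiv. rewrite Rabs_mult, Rabs_inv.
  apply Rmult_lt_reg_r with (Rabs h); [assumption|].
  rewrite Rmult_assoc, Rinv_l, Rmult_1_r by lra.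
  eapply Rle_lt_trans; [exact H|].
  rewrite <- (pow2_abs h). simpl. rewrite Rmult_1_r, <- Rmult_assoc.
  apply Rmult_lt_compat_r; [assumption|].
  apply Rle_lt_trans with (K' * Rabs h).
  - apply Rmult_le_compat_r; [lra|apply Rmax_l].
  - apply Rmult_lt_reg_r with (/ K'); [now apply Rinv_0_lt_compat|].
    replace (K' * Rabs h * / K') with (Rabs h) by (field; lra). fold (eps / K'). lra.
Qed.

Lemma exp_remainder v : Rabs (exp v - 1 - v) <= v ^ 2 * exp (Rabs v).
Proof.
  pose proof (exp_ineq1_le v) as H1. rewrite Rabs_pos_eq by lra.
  assert (H2 : exp v - 1 <= v * exp v).
  { pose proof (exp_ineq1_le (- v)) as H. rewrite exp_Ropp in H. pose proof (exp_pos v).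
    apply Rmult_le_compat_r with (r := exp v) in H; [|lra].
    rewrite Rinv_l in H by lra. lra. }
  pose proof (exp_pos v).
  destruct (Rle_or_lt 0 v) as [Hv|Hv].
  - rewrite Rabs_pos_eq by lra. nra.
  - rewrite Rabs_left by lra.
    assert (1 <= exp (- v)) by (pose proof (exp_ineq1_le (- v)); lra).
    assert (exp v - 1 - v <= v ^ 2) by nra. nra.
Qed.

Section ExpSum.

Variable c : nat -> R.
Hypothesis Hc : forall k, INR k + 1 <= c k.

Lemma freq_pos k : 1 <= c k.
Proof. specialize (Hc k). pose proof (pos_INR k). lra. Qed.

Lemma ex_expsum t : 0 < t -> ex_series (fun k => exp (- (c k * t))).
Proof.
  intros Ht. pose proof (exp_opp_unit t Ht).
  apply (ex_series_geom_bound _ (exp (- t)) (exp (- t))); [assumption|].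
  intros k. rewrite Rabs_pos_eq by apply Rlt_le, exp_pos.
  now apply exp_opp_le_geom.
Qed.

(** Half of the exponent absorbs the factor [c k], by [x exp (-x) <= 1] at [x = c k t / 2].
    Iterating this gives the summability of the differentiated series. *)
Lemma freq_mul_exp_le t k : 0 < t -> c k * exp (- (c k * t)) <= 2 / t * exp (- (c k * (t / 2))).
Proof.
  intros Ht. pose proof (mul_exp_opp_le (c k * (t / 2))) as H.
  replace (- (c k * t)) with (- (c k * (t / 2)) + - (c k * (t / 2))) by field.
  rewrite exp_plus, <- Rmult_assoc. apply Rmult_le_compat_r; [apply Rlt_le, exp_pos|].
  apply Rmult_le_reg_r with (t / 2); [lra|].
  replace (2 / t * (t / 2)) with 1 by (field; lra). lra.
Qed.

Lemma ex_expsum1 t : 0 < t -> ex_series (fun k => c k * exp (- (c k * t))).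
Proof.
  intros Ht.
  apply (@ex_series_le R_AbsRing R_CompleteNormedModule _
    (fun k => 2 / t * exp (- (c k * (t / 2))))).
  - intros k. unfold norm; simpl. unfold abs; simpl.
    pose proof (freq_pos k). pose proof (exp_pos (- (c k * t))).
    rewrite Rabs_pos_eq by nra. now apply freq_mul_exp_le.
  - apply (@ex_series_scal_l R_AbsRing). apply ex_expsum; lra.
Qed.

Lemma ex_expsum2 t : 0 < t -> ex_series (fun k => c k * (c k * exp (- (c k * t)))).
Proof.
  intros Ht.
  apply (@ex_series_le R_AbsRing R_CompleteNormedModule _
    (fun k => 2 / t * (c k * exp (- (c k * (t / 2)))))).
  - intros k. unfold norm; simpl. unfold abs; simpl.
    pose proof (freq_pos k). pose proof (exp_pos (- (c k * t))).
    rewrite Rabs_pos_eq by (repeat apply Rmult_le_pos; lra).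
    pose proof (freq_mul_exp_le t k Ht). nra.
  - apply (@ex_series_scal_l R_AbsRing). apply ex_expsum1; lra.
Qed.

Lemma expsum_nonneg t : 0 < t -> 0 <= expsum c t.
Proof. intros Ht. apply Series_nonneg; [intros; apply Rlt_le, exp_pos|now apply ex_expsum]. Qed.

Lemma expsum1_nonneg t : 0 < t -> 0 <= expsum1 c t.
Proof.
  intros Ht. apply Series_nonneg; [|now apply ex_expsum1].
  intros k. pose proof (freq_pos k). pose proof (exp_pos (- (c k * t))). nra.
Qed.

(** For [|h| < t/2] the remainder of each term is at most [h^2 (c k)^2 exp (- c k t / 2)], so the
    second derivative series at [t/2] serves as the constant. *)
Lemma is_derive_expsum t : 0 < t -> is_derive (expsum c) t (- expsum1 c t).
Proof.
  intros Ht.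
  apply (is_derive_quadratic_remainder _ _ _
    (Series (fun k => c k * (c k * exp (- (c k * (t / 2)))))) (t / 2)); [lra|].
  intros h Hh.
  assert (Hth : 0 < t + h) by (apply Rabs_def2 in Hh; lra).
  unfold expsum, expsum1.
  replace (h * - Series (fun k => c k * exp (- (c k * t))))
    with (Series (fun k => (- h) * (c k * exp (- (c k * t))))) by (rewrite Series_scal_l; ring).
  rewrite <- Series_minus by (apply ex_expsum; lra).
  assert (E1 : ex_series (fun k => exp (- (c k * (t + h))) - exp (- (c k * t))))
    by (apply @ex_series_minus; apply ex_expsum; lra).
  assert (E2 : ex_series (fun k => - h * (c k * exp (- (c k * t)))))
    by (apply (@ex_series_scal_l R_AbsRing); now apply ex_expsum1).
  rewrite <- Series_minus by assumption.
  assert (E3 := ex_series_scal_l (V := R_NormedModule) (h ^ 2) _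
    (ex_expsum2 (t / 2) ltac:(lra))).
  rewrite Rmult_comm, <- Series_scal_l.
  assert (B : forall k,
    Rabs (exp (- (c k * (t + h))) - exp (- (c k * t)) - - h * (c k * exp (- (c k * t))))
    <= h ^ 2 * (c k * (c k * exp (- (c k * (t / 2)))))).
  { intros k. pose proof (freq_pos k) as Hk.
    replace (exp (- (c k * (t + h))) - exp (- (c k * t)) - - h * (c k * exp (- (c k * t))))
      with (exp (- (c k * t)) * (exp (- (c k * h)) - 1 - - (c k * h))).
    2: { replace (- (c k * (t + h))) with (- (c k * t) + - (c k * h)) by ring.
         rewrite exp_plus; ring. }
    rewrite Rabs_mult, (Rabs_pos_eq (exp _)) by apply Rlt_le, exp_pos.
    eapply Rle_trans;
      [apply Rmult_le_compat_l; [apply Rlt_le, exp_pos|apply exp_remainder]|].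
    rewrite Rabs_Ropp, Rabs_mult, (Rabs_pos_eq (c k)) by lra.
    replace (exp (- (c k * t)) * ((- (c k * h)) ^ 2 * exp (c k * Rabs h)))
      with (h ^ 2 * (c k * (c k * exp (- (c k * t) + c k * Rabs h))))
      by (rewrite exp_plus; ring).
    apply Rmult_le_compat_l; [apply pow2_ge_0|].
    apply Rmult_le_compat_l; [lra|]. apply Rmult_le_compat_l; [lra|].
    apply exp_le_compat. nra. }
  assert (EA : ex_series (fun k => Rabs (exp (- (c k * (t + h))) - exp (- (c k * t))
      - - h * (c k * exp (- (c k * t)))))).
  { apply (@ex_series_le R_AbsRing R_CompleteNormedModule _
      (fun k => h ^ 2 * (c k * (c k * exp (- (c k * (t / 2))))))); [|exact E3].
    intros k. unfold norm; simpl. unfold abs; simpl. rewrite Rabs_Rabsolu. apply B. }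
  eapply Rle_trans; [apply Series_Rabs, EA|]. now apply Series_le_gen.
Qed.

End ExpSum.

(** Only positive integers are indexed: in [ev] the integer 0 is the constant 1, and the factor 2 in
    [ev] and [od] accounts for the negative integers. *)
Definition freq_even (k : nat) : R := PI * (2 * INR k + 2) ^ 2.
Definition freq_odd (k : nat) : R := PI * (2 * INR k + 1) ^ 2.

Lemma PI_gt_3 : 3 < PI.
Proof. pose proof PI2_3_2. lra. Qed.

Lemma freq_even_ge k : INR k + 1 <= freq_even k.
Proof. unfold freq_even. pose proof (pos_INR k). pose proof PI_gt_3. nra. Qed.

Lemma freq_odd_ge k : INR k + 1 <= freq_odd k.
Proof. unfold freq_odd. pose proof (pos_INR k). pose proof PI_gt_3. nra. Qed.

Definition ev (t : R) : R := 1 + 2 * expsum freq_even t.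
Definition od (t : R) : R := 2 * expsum freq_odd t.
(* [ev1 t = - t ev'(t)] and [od1 t = - t od'(t)]. *)
Definition ev1 (t : R) : R := t * (2 * expsum1 freq_even t).
Definition od1 (t : R) : R := t * (2 * expsum1 freq_odd t).

Lemma is_derive_ev t : 0 < t -> is_derive ev t (- (ev1 t / t)).
Proof.
  intros Ht. replace (- (ev1 t / t)) with (0 + 2 * - expsum1 freq_even t)
    by (unfold ev1; field; lra).
  unfold ev. apply @is_derive_plus; [apply @is_derive_const|].
  apply is_derive_scal. apply is_derive_expsum; [apply freq_even_ge|exact Ht].
Qed.

Lemma is_derive_od t : 0 < t -> is_derive od t (- (od1 t / t)).
Proof.
  intros Ht. replace (- (od1 t / t)) with (2 * - expsum1 freq_odd t)
    by (unfold od1; field; lra).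
  unfold od.
  apply is_derive_scal. apply is_derive_expsum; [apply freq_odd_ge|exact Ht].
Qed.

Lemma jacobi_quadruple t : jacobi (4 * t) = ev t.
Proof.
  unfold jacobi, ev, expsum. do 2 f_equal. apply Series_ext. intros k.
  do 2 f_equal. unfold freq_even. rewrite S_INR. ring.
Qed.

Lemma jacobi_ev_od t : 0 < t -> jacobi t = ev t + od t.
Proof.
  intros Ht. unfold jacobi, ev, od, expsum.
  set (f := fun k => exp (- (PI * INR (S k) ^ 2 * t))).
  assert (E0 : forall k, f (2 * k)%nat = exp (- (freq_odd k * t))).
  { intros k. unfold f, freq_odd. rewrite S_INR, mult_INR. reflexivity. }
  assert (E1 : forall k, f (2 * k + 1)%nat = exp (- (freq_even k * t))).
  { intros k. unfold f, freq_even. rewrite S_INR, plus_INR, mult_INR.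
    simpl (INR 1). simpl (INR 2). do 3 f_equal. ring. }
  rewrite (Series_even_odd f).
  - rewrite (Series_ext _ _ E0), (Series_ext _ _ E1). ring.
  - apply (ex_expsum (fun k => PI * INR (S k) ^ 2)); [|exact Ht].
    intros k. rewrite S_INR. pose proof (pos_INR k). pose proof PI_gt_3. nra.
  - eapply ex_series_ext; [intros; symmetry; apply E0|]. apply ex_expsum; [apply freq_odd_ge|exact Ht].
  - eapply ex_series_ext; [intros; symmetry; apply E1|]. apply ex_expsum; [apply freq_even_ge|exact Ht].
Qed.

Lemma theta3_ev_od t : 0 < t -> theta3 t = ev t + od t.
Proof.
  intros Ht. rewrite <- jacobi_ev_od by exact Ht. unfold theta3, jacobi.
  set (f := fun k : Z => exp (- PI * IZR k ^ 2 * t)).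
  assert (E : forall k, 2 * exp (- (PI * INR (S k) ^ 2 * t))
                        = f (Z.of_nat (S k)) + f (- Z.of_nat (S k))%Z).
  { intros k. unfold f. rewrite opp_IZR, <- INR_IZR_INZ.
    replace (- PI * (- INR (S k)) ^ 2 * t) with (- (PI * INR (S k) ^ 2 * t)) by ring.
    replace (- PI * INR (S k) ^ 2 * t) with (- (PI * INR (S k) ^ 2 * t)) by ring. ring. }
  rewrite sumZ_series.
  - rewrite <- (Series_ext _ _ E), Series_scal_l. f_equal.
    unfold f. rewrite <- exp_0. f_equal. ring.
  - eapply ex_series_ext; [exact E|]. apply (@ex_series_scal_l R_AbsRing).
    apply (ex_expsum (fun k => PI * INR (S k) ^ 2)); [|exact Ht].
    intros k. rewrite S_INR. pose proof (pos_INR k). pose proof PI_gt_3. nra.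
Qed.

Lemma theta_o_od t : 0 < t -> theta_o t = od t.
Proof.
  intros Ht. unfold theta_o, od, expsum.
  set (f := fun k : Z => exp (- PI * (2 * IZR k + 1) ^ 2 * t)).
  set (g := fun k => exp (- (freq_odd k * t))).
  assert (Hg : ex_series g) by (apply ex_expsum; [apply freq_odd_ge|exact Ht]).
  (* The integers [k+1] and [-(k+1)] yield the odd numbers [2k+3] and [-(2k+1)], so the pairing is
     shifted by one; the term at 0 supplies the missing [g 0]. *)
  assert (E : forall k, g (S k) + g k = f (Z.of_nat (S k)) + f (- Z.of_nat (S k))%Z).
  { intros k. unfold f, g, freq_odd. rewrite opp_IZR, <- INR_IZR_INZ, S_INR.
    f_equal; f_equal; ring. }
  assert (Hg1 : ex_series (fun k => g (S k))) by now apply ex_series_incr_1 in Hg.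
  rewrite sumZ_series.
  - rewrite <- (Series_ext _ _ E), Series_plus by assumption.
    rewrite (Series_incr_1 g) by assumption.
    replace (f 0%Z) with (g 0%nat); [ring|].
    unfold f, g, freq_odd. simpl. f_equal. ring.
  - eapply ex_series_ext; [exact E|]. now apply @ex_series_plus.
Qed.

(** * Estimates on [[1/2, oo)] *)

(** Since [y >= 1/2], [x <= y exp (2 (x - y))], and [1 + K (x - y) <= exp (K (x - y))]. The total
    growth rate [2 + K] is absorbed by [c]. *)
Lemma mul_exp_decay c K x y : / 2 <= y <= x -> 0 <= K -> 2 + K <= c ->
  x * exp (- (c * x)) * (1 + K * (x - y)) <= y * exp (- (c * y)).
Proof.
  intros Hy HK Hc. set (d := x - y). assert (Hd : 0 <= d) by (unfold d; lra).
  assert (Hx : x <= y * exp (2 * d)).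
  { pose proof (exp_ineq1_le (2 * d)). replace x with (y + d) by (unfold d; ring). nra. }
  assert (HKd : 1 + K * d <= exp (K * d)) by apply exp_ineq1_le.
  apply Rle_trans with (y * exp (2 * d) * exp (- (c * x)) * exp (K * d)).
  - apply Rmult_le_compat; [|nra| |exact HKd].
    + pose proof (exp_pos (- (c * x))). nra.
    + apply Rmult_le_compat_r; [apply Rlt_le, exp_pos|exact Hx].
  - rewrite !Rmult_assoc, <- !exp_plus. apply Rmult_le_compat_l; [lra|].
    apply exp_le_compat. replace x with (y + d) by (unfold d; ring). nra.
Qed.

(** Here [c y - 1/2 >= 1], so adding [c (x - y)] to it costs at most a factor
    [1 + c (x - y) <= exp (c (x - y))]. The shift by one half comes from differentiating [sqrt w] in
    the dual expression. *)
Lemma half_shift_exp_decr c x y : / 2 <= y <= x -> 3 <= c ->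
  x * (c * exp (- (c * x))) - / 2 * exp (- (c * x))
  <= y * (c * exp (- (c * y))) - / 2 * exp (- (c * y)).
Proof.
  intros Hy Hc. set (d := x - y). assert (Hd : 0 <= d) by (unfold d; lra).
  replace (x * (c * exp (- (c * x))) - / 2 * exp (- (c * x)))
    with ((c * x - / 2) * exp (- (c * x))) by ring.
  replace (y * (c * exp (- (c * y))) - / 2 * exp (- (c * y)))
    with ((c * y - / 2) * exp (- (c * y))) by ring.
  replace (exp (- (c * y))) with (exp (c * d) * exp (- (c * x)))
    by (rewrite <- exp_plus; f_equal; unfold d; ring).
  rewrite <- Rmult_assoc. apply Rmult_le_compat_r; [apply Rlt_le, exp_pos|].
  pose proof (exp_ineq1_le (c * d)). replace x with (y + d) by (unfold d; ring).
  assert (1 <= c * y - / 2) by nra. assert (0 <= c * d) by nra. nra.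
Qed.

(** For comparing each even frequency with the odd one just below it. After division by
    [exp (- c y)] the claim is [w (1 - p q) <= 1 - p]: the bounds [1 - q <= e d] and
    [2 d p <= 1 - p] give [1 - p q <= (1 - p)(1 + e/2)], and [y >= 1/2] gives [w (1 + e/2) <= 1]. *)
Lemma exp_gap_antitone c c' x y : / 2 <= y <= x -> 2 <= c <= c' ->
  exp (- (c' * y)) - exp (- (c' * x)) <= exp (- (c * y)) - exp (- (c * x)).
Proof.
  intros Hy Hc. set (d := x - y). set (e := c' - c).
  assert (Hd : 0 <= d) by (unfold d; lra). assert (He : 0 <= e) by (unfold e; lra).
  replace (exp (- (c * x))) with (exp (- (c * y)) * exp (- (c * d)))
    by (rewrite <- exp_plus; f_equal; unfold d; ring).
  replace (exp (- (c' * x))) with (exp (- (c * y)) * (exp (- (e * y)) * (exp (- (c * d)) * exp (- (e * d)))))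
    by (rewrite <- !exp_plus; f_equal; unfold d, e; ring).
  replace (exp (- (c' * y))) with (exp (- (c * y)) * exp (- (e * y)))
    by (rewrite <- !exp_plus; f_equal; unfold e; ring).
  set (p := exp (- (c * d))). set (q := exp (- (e * d))). set (w := exp (- (e * y))).
  assert (Hmain : w * (1 - p * q) <= 1 - p).
  { assert (Hp : 0 < p) by apply exp_pos. assert (Hw : 0 < w) by apply exp_pos.
    assert (Hq : 1 - e * d <= q) by (pose proof (exp_ineq1_le (- (e * d))); unfold q; lra).
    assert (Hpc : c * d * p <= 1 - p).
    { pose proof (exp_ineq1_le (c * d)) as H. apply Rmult_le_compat_r with (r := p) in H; [|lra].
      unfold p in H at 2. rewrite <- exp_plus, Rplus_opp_r, exp_0 in H. lra. }
    assert (Hwe : w * (1 + e / 2) <= 1).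
    { pose proof (exp_ineq1_le (e * y)) as H. apply Rmult_le_compat_l with (r := w) in H; [|lra].
      unfold w in H at 2. rewrite <- exp_plus, Rplus_opp_l, exp_0 in H.
      assert (0 <= w * (e * (y - / 2))) by (repeat apply Rmult_le_pos; lra). lra. }
    assert (Hp1 : 0 <= 1 - p) by (assert (0 <= c * d * p) by (repeat apply Rmult_le_pos; lra); lra).
    assert (H1 : 1 - p * q <= (1 - p) * (1 + e / 2)).
    { assert (p * (1 - e * d) <= p * q) by (apply Rmult_le_compat_l; lra).
      assert (2 * d * p <= 1 - p) by (assert (0 <= d * p) by nra; nra). nra. }
    apply Rle_trans with (w * ((1 - p) * (1 + e / 2))); [apply Rmult_le_compat_l; lra|]. nra. }
  pose proof (exp_pos (- (c * y))). nra.
Qed.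

Lemma expsum_half_bound (c : nat -> R) a q : 0 <= a -> (forall k, a * (INR k + 1) <= c k) ->
  exp (- (a / 2)) <= q -> q < 1 -> expsum c (/ 2) <= q / (1 - q).
Proof.
  intros Ha Hac Hq Hq1.
  assert (Hq0 : 0 < q) by (pose proof (exp_pos (- (a / 2))); lra).
  eapply Rle_trans; [apply Rle_abs|]. apply Series_geom_bound; [lra|]. intros k.
  rewrite Rabs_pos_eq by apply Rlt_le, exp_pos.
  apply Rle_trans with (exp (- (a / 2)) ^ S k).
  - rewrite exp_mult_INR. apply exp_le_compat. rewrite S_INR. specialize (Hac k). nra.
  - apply (pow_incr _ _ (S k)). split; [apply Rlt_le, exp_pos|exact Hq].
Qed.

Section FrequencyBounds.

Variable c : nat -> R.
Hypothesis Hc : forall k, INR k + 1 <= c k.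

Lemma expsum_decr x y : 0 < y <= x -> expsum c x <= expsum c y.
Proof.
  intros H. apply Series_le_gen; try (apply ex_expsum; [exact Hc|lra]).
  intros k. apply exp_le_compat. pose proof (freq_pos c Hc k). nra.
Qed.

Lemma mul_expsum1_decay K x y : / 2 <= y <= x -> 0 <= K -> (forall k, 2 + K <= c k) ->
  x * expsum1 c x * (1 + K * (x - y)) <= y * expsum1 c y.
Proof.
  intros Hy HK HcK. unfold expsum1.
  rewrite Rmult_comm, <- Rmult_assoc, <- !Series_scal_l.
  apply Series_le_gen;
    try (apply (@ex_series_scal_l R_AbsRing); apply ex_expsum1; [exact Hc|lra]).
  intros k. pose proof (mul_exp_decay (c k) K x y Hy HK (HcK k)).
  pose proof (freq_pos c Hc k). nra.
Qed.

Lemma half_shift_expsum_decr x y : / 2 <= y <= x -> (forall k, 3 <= c k) ->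
  x * expsum1 c x - / 2 * expsum c x <= y * expsum1 c y - / 2 * expsum c y.
Proof.
  intros Hy Hc3.
  assert (E1 : forall t, / 2 <= t -> ex_series (fun k => t * (c k * exp (- (c k * t)))))
    by (intros; apply (@ex_series_scal_l R_AbsRing); apply ex_expsum1; [exact Hc|lra]).
  assert (E0 : forall t, / 2 <= t -> ex_series (fun k => / 2 * exp (- (c k * t))))
    by (intros; apply (@ex_series_scal_l R_AbsRing); apply ex_expsum; [exact Hc|lra]).
  unfold expsum, expsum1. rewrite <- !Series_scal_l, <- !Series_minus
    by first [apply E1; lra | apply E0; lra].
  apply Series_le_gen.
  - intros k. now apply half_shift_exp_decr.
  - apply @ex_series_minus; [apply E1|apply E0]; lra.
  - apply @ex_series_minus; [apply E1|apply E0]; lra.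
Qed.

Lemma expsum_gap x y : / 2 <= y <= x ->
  expsum c y - expsum c x <= (x - y) * expsum1 c (/ 2).
Proof.
  intros Hy. unfold expsum, expsum1.
  rewrite <- Series_scal_l, <- Series_minus by (apply ex_expsum; [exact Hc|lra]).
  apply Series_le_gen.
  - intros k. pose proof (freq_pos c Hc k).
    replace (exp (- (c k * x))) with (exp (- (c k * y)) * exp (- (c k * (x - y))))
      by (rewrite <- exp_plus; f_equal; ring).
    pose proof (exp_ineq1_le (- (c k * (x - y)))) as H1.
    assert (H2 : exp (- (c k * y)) <= exp (- (c k * / 2))) by (apply exp_le_compat; nra).
    pose proof (exp_pos (- (c k * y))). assert (0 <= c k * (x - y)) by nra.
    apply Rle_trans with (exp (- (c k * y)) * (c k * (x - y))); nra.
  - apply @ex_series_minus; apply ex_expsum; [exact Hc|lra|exact Hc|lra].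
  - apply (@ex_series_scal_l R_AbsRing). apply ex_expsum1; [exact Hc|lra].
Qed.

(** Of the two factors [exp (- c k / 4)], one absorbs [c k] at the cost of a constant 4 and the
    other is dominated geometrically. *)
Lemma expsum1_half_bound a q : 0 <= a -> (forall k, a * (INR k + 1) <= c k) ->
  exp (- (a / 4)) <= q -> q < 1 -> expsum1 c (/ 2) <= 4 * q / (1 - q).
Proof.
  intros Ha Hac Hq Hq1.
  assert (Hq0 : 0 < q) by (pose proof (exp_pos (- (a / 4))); lra).
  eapply Rle_trans; [apply Rle_abs|]. apply Series_geom_bound; [lra|]. intros k.
  pose proof (freq_pos c Hc k). pose proof (exp_pos (- (c k * / 2))).
  rewrite Rabs_pos_eq by nra.
  replace (- (c k * / 2)) with (- (c k / 4) + - (c k / 4)) by field. rewrite exp_plus.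
  pose proof (mul_exp_opp_le (c k / 4)).
  assert (exp (- (c k / 4)) <= q * q ^ k).
  { apply Rle_trans with (exp (- (a / 4)) ^ S k).
    - rewrite exp_mult_INR. apply exp_le_compat. rewrite S_INR. specialize (Hac k). nra.
    - apply (pow_incr _ _ (S k)). split; [apply Rlt_le, exp_pos|exact Hq]. }
  pose proof (exp_pos (- (c k / 4))). nra.
Qed.

End FrequencyBounds.

Lemma freq_even_ge12 k : 12 * (INR k + 1) <= freq_even k.
Proof. unfold freq_even. pose proof (pos_INR k). pose proof PI_gt_3. nra. Qed.

Lemma freq_odd_ge3 k : 3 * (INR k + 1) <= freq_odd k.
Proof. unfold freq_odd. pose proof (pos_INR k). pose proof PI_gt_3. nra. Qed.

(** Taylor gives [1 + 3/4 + 9/32 > 2]. Powers of this bound yield [exp (3/2) >= 4] and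
    [exp 3 >= 16], which feed the ratios [q] below. *)
Lemma exp_three_quarters : 2 <= exp (3 / 4).
Proof. pose proof (exp_ge_taylor (3 / 4) 2 ltac:(lra)) as H. simpl in H. lra. Qed.

Lemma ev_ge_1 t : 0 < t -> 1 <= ev t.
Proof. intros Ht. unfold ev. pose proof (expsum_nonneg _ freq_even_ge t Ht). lra. Qed.

Lemma od_nonneg t : 0 < t -> 0 <= od t.
Proof. intros Ht. unfold od. pose proof (expsum_nonneg _ freq_odd_ge t Ht). lra. Qed.

Lemma ev1_nonneg t : 0 < t -> 0 <= ev1 t.
Proof. intros Ht. unfold ev1. pose proof (expsum1_nonneg _ freq_even_ge t Ht). nra. Qed.

Lemma od1_nonneg t : 0 < t -> 0 <= od1 t.
Proof. intros Ht. unfold od1. pose proof (expsum1_nonneg _ freq_odd_ge t Ht). nra. Qed.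

Lemma ev_decr x y : 0 < y <= x -> ev x <= ev y.
Proof. intros H. unfold ev. pose proof (expsum_decr _ freq_even_ge x y H). lra. Qed.

Lemma od_decr x y : 0 < y <= x -> od x <= od y.
Proof. intros H. unfold od. pose proof (expsum_decr _ freq_odd_ge x y H). lra. Qed.

(** The frequency bound [12 = 2 + 10] provides the rate 10, which matches the slope in
    [ev_add_od_gap]. *)
Lemma ev1_decay x y : / 2 <= y <= x -> ev1 x * (1 + 10 * (x - y)) <= ev1 y.
Proof.
  intros H. unfold ev1.
  pose proof (mul_expsum1_decay _ freq_even_ge 10 x y H ltac:(lra)
    ltac:(intros k; pose proof (freq_even_ge12 k); pose proof (pos_INR k); lra)). lra.
Qed.

Lemma od1_decr x y : / 2 <= y <= x -> od1 x <= od1 y.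
Proof.
  intros H. unfold od1.
  pose proof (mul_expsum1_decay _ freq_odd_ge 0 x y H ltac:(lra)
    ltac:(intros k; pose proof (freq_odd_ge3 k); pose proof (pos_INR k); lra)). lra.
Qed.

Lemma ev1_half_shift_decr x y : / 2 <= y <= x -> ev1 x - ev x / 2 <= ev1 y - ev y / 2.
Proof.
  intros H. unfold ev1, ev.
  pose proof (half_shift_expsum_decr _ freq_even_ge x y H
    ltac:(intros k; pose proof (freq_even_ge12 k); pose proof (pos_INR k); lra)). lra.
Qed.

Lemma od1_half_shift_decr x y : / 2 <= y <= x -> od1 x - od x / 2 <= od1 y - od y / 2.
Proof.
  intros H. unfold od1, od.
  pose proof (half_shift_expsum_decr _ freq_odd_ge x y H
    ltac:(intros k; pose proof (freq_odd_ge3 k); pose proof (pos_INR k); lra)). lra.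
Qed.

Lemma od_le_1 t : / 2 <= t -> od t <= 1.
Proof.
  intros Ht. eapply Rle_trans; [apply (od_decr t (/ 2)); lra|]. unfold od.
  (* The ratio [1/3] makes the geometric bound [q / (1 - q)] equal to [1/2]. *)
  pose proof (expsum_half_bound _ 3 (/ 3) ltac:(lra) freq_odd_ge3) as H.
  assert (Hq : exp (- (3 / 2)) <= / 3).
  { rewrite exp_Ropp. apply Rinv_le_contravar; [lra|].
    replace (3 / 2) with (3 / 4 + 3 / 4) by field. rewrite exp_plus.
    pose proof exp_three_quarters. nra. }
  specialize (H Hq ltac:(lra)). lra.
Qed.

Lemma ev_sub_od_incr x y : / 2 <= y <= x -> ev y - od y <= ev x - od x.
Proof.
  intros Hy. unfold ev, od.
  assert (expsum freq_even y - expsum freq_even x <= expsum freq_odd y - expsum freq_odd x); [|lra].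
  unfold expsum.
  rewrite <- !Series_minus by (apply ex_expsum; [apply freq_even_ge || apply freq_odd_ge|lra]).
  apply Series_le_gen.
  - intros k. apply exp_gap_antitone; [exact Hy|]. 
    pose proof (freq_odd_ge3 k). pose proof (pos_INR k). split; [lra|].
    unfold freq_odd, freq_even. pose proof PI_gt_3. apply Rmult_le_compat_l; nra.
  - apply @ex_series_minus; apply ex_expsum; try apply freq_even_ge; lra.
  - apply @ex_series_minus; apply ex_expsum; try apply freq_odd_ge; lra.
Qed.

(** The slope at [1/2] bounds all later ones; the ratios [1/2] and [1/16] bound it by
    [2 (4 + 4/15) < 10]. *)
Lemma ev_add_od_gap x y : / 2 <= y <= x -> ev y + od y <= ev x + od x + 10 * (x - y).
Proof.
  intros Hy. unfold ev, od.
  pose proof (expsum_gap _ freq_even_ge x y Hy) as H0.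
  pose proof (expsum_gap _ freq_odd_ge x y Hy) as H1.
  pose proof exp_three_quarters as He.
  assert (B1 : expsum1 freq_odd (/ 2) <= 4 * / 2 / (1 - / 2)).
  { apply (expsum1_half_bound _ freq_odd_ge 3); [lra|exact freq_odd_ge3| |lra].
    rewrite exp_Ropp. apply Rinv_le_contravar; lra. }
  assert (B0 : expsum1 freq_even (/ 2) <= 4 * / 16 / (1 - / 16)).
  { apply (expsum1_half_bound _ freq_even_ge 12); [lra|exact freq_even_ge12| |lra].
    rewrite exp_Ropp. apply Rinv_le_contravar; [lra|].
    replace (12 / 4) with ((3 / 4 + 3 / 4) + (3 / 4 + 3 / 4)) by field. rewrite !exp_plus.
    assert (4 <= exp (3 / 4) * exp (3 / 4)) by nra. nra. }
  nra.
Qed.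

(** * Self-duality and monotonicity *)

Lemma ev_dual w : 0 < w -> ev (/ (4 * w)) = sqrt w * (ev w + od w).
Proof.
  intros Hw. rewrite <- jacobi_quadruple, <- jacobi_ev_od by exact Hw.
  replace (4 * / (4 * w)) with (/ w) by (field; lra). now apply jacobi_inversion.
Qed.

(** Inversion at [4w] gives [jacobi (1/(4w)) = 2 sqrt w * ev w], from which [ev_dual] is
    subtracted. *)
Lemma od_dual w : 0 < w -> od (/ (4 * w)) = sqrt w * (ev w - od w).
Proof.
  intros Hw.
  assert (H4 : 0 < / (4 * w)) by (apply Rinv_0_lt_compat; lra).
  pose proof (jacobi_ev_od _ H4) as H.
  rewrite jacobi_inversion, jacobi_quadruple, sqrt_mult, ev_dual in H by lra.
  replace (sqrt 4) with 2 in H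
    by (replace 4 with (2 * 2) by ring; symmetry; apply sqrt_square; lra).
  lra.
Qed.

Definition pairing (x y : R) : R := ev x * ev y + ev x * od y + od x * ev y - od x * od y.

Lemma F5_pairing r s : 0 < r -> 0 < s -> F5 r s = pairing (r * s) (r / s).
Proof.
  intros Hr Hs. unfold F5, pairing.
  assert (0 < r * s) by nra. assert (0 < r / s) by now apply Rdiv_lt_0_compat.
  rewrite !theta3_ev_od, !theta_o_od by assumption. ring.
Qed.

Lemma pairing_sym x y : pairing x y = pairing y x.
Proof. unfold pairing; ring. Qed.

Lemma pairing_dual x w : 0 < w ->
  pairing x (/ (4 * w)) = 2 * (sqrt w * (ev x * ev w + od x * od w)).
Proof. intros Hw. unfold pairing. rewrite ev_dual, od_dual by exact Hw. ring. Qed.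

Lemma F5_dual r s : 0 < r -> 0 < s ->
  F5 r s = 2 * (sqrt (s / (4 * r)) * (ev (r * s) * ev (s / (4 * r)) + od (r * s) * od (s / (4 * r)))).
Proof.
  intros Hr Hs. rewrite F5_pairing by assumption.
  rewrite <- pairing_dual by (apply Rdiv_lt_0_compat; lra).
  f_equal. field. lra.
Qed.

(** The change [r -> 1/(4r)] exchanges the two arguments [r s] and [s/(4r)] of the symmetric
    expression in [F5_dual]; only the square root in front changes. *)
Lemma F5_reflect_r r s : 0 < r -> 0 < s -> F5 (/ (4 * r)) s = 2 * r * F5 r s.
Proof.
  intros Hr Hs. assert (Hr4 : 0 < / (4 * r)) by (apply Rinv_0_lt_compat; lra).
  rewrite (F5_dual r), (F5_dual (/ (4 * r))) by assumption.
  replace (s / (4 * / (4 * r))) with (r * s) by (field; lra).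
  replace (/ (4 * r) * s) with (s / (4 * r)) by (field; lra).
  assert (Hq : sqrt (r * s) = 2 * r * sqrt (s / (4 * r))).
  { replace (r * s) with ((2 * r) ^ 2 * (s / (4 * r))) by (field; lra).
    rewrite sqrt_mult, sqrt_pow2; [reflexivity|lra|apply pow2_ge_0|].
    apply Rlt_le, Rdiv_lt_0_compat; lra. }
  rewrite Hq. ring.
Qed.

Lemma F5_reflect_s r s : 0 < r -> 0 < s -> F5 r (/ s) = F5 r s.
Proof.
  intros Hr Hs. rewrite !F5_pairing by (assumption || now apply Rinv_0_lt_compat).
  rewrite pairing_sym. f_equal; field; lra.
Qed.

(** * Rules of differentiation and the self-dual point *)

Lemma is_derive_Rmult (f g : R -> R) (x df dg : R) :
  is_derive f x df -> is_derive g x dg ->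
  is_derive (fun t => f t * g t) x (df * g x + f x * dg).
Proof. intros Hf Hg. apply (is_derive_mult f g x df dg Hf Hg). intros; apply Rmult_comm. Qed.

Lemma is_derive_Rplus (f g : R -> R) (x df dg : R) :
  is_derive f x df -> is_derive g x dg ->
  is_derive (fun t => f t + g t) x (df + dg).
Proof. intros Hf Hg. exact (is_derive_plus f g x df dg Hf Hg). Qed.

Lemma is_derive_Rcomp (f g : R -> R) (x df dg l : R) :
  is_derive f (g x) df -> is_derive g x dg -> l = dg * df ->
  is_derive (fun t => f (g t)) x l.
Proof. intros Hf Hg ->. exact (is_derive_comp f g x df dg Hf Hg). Qed.

Lemma is_derive_value (f : R -> R) (x l l' : R) : is_derive f x l -> l = l' -> is_derive f x l'.
Proof. now intros H <-. Qed.

Lemma le_of_nonneg_derive (f df : R -> R) a b : a <= b ->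
  (forall x, a <= x <= b -> is_derive f x (df x)) ->
  (forall x, a <= x <= b -> 0 <= df x) -> f a <= f b.
Proof.
  intros Hab Hd Hp.
  destruct (MVT_gen f a b df) as [c [Hc Heq]].
  - intros x. rewrite Rmin_left, Rmax_right by exact Hab. intros Hx. apply Hd; lra.
  - intros x. rewrite Rmin_left, Rmax_right by exact Hab. intros Hx.
    apply derivable_continuous_pt. exists (df x). now apply is_derive_Reals, Hd.
  - rewrite Rmin_left, Rmax_right in Hc by exact Hab. specialize (Hp c Hc). nra.
Qed.

(** With [f1 t = - t f'(t)] the dilation factor drops out, so all derivatives in [s] share the
    factor [1/s]. *)
Lemma is_derive_dilation (f f1 : R -> R) a s :
  (forall t, 0 < t -> is_derive f t (- (f1 t / t))) -> 0 < a -> 0 < s ->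
  is_derive (fun u => f (a * u)) s (- (f1 (a * s) / s)).
Proof.
  intros H Ha Hs. assert (0 < a * s) by nra.
  eapply is_derive_Rcomp; [now apply H| |].
  - apply is_derive_scal, is_derive_id.
  - unfold one; simpl. field. lra.
Qed.

Lemma is_derive_inverse_dilation (f f1 : R -> R) a s :
  (forall t, 0 < t -> is_derive f t (- (f1 t / t))) -> 0 < a -> 0 < s ->
  is_derive (fun u => f (a / u)) s (f1 (a / s) / s).
Proof.
  intros H Ha Hs. assert (0 < a / s) by now apply Rdiv_lt_0_compat.
  apply is_derive_Rcomp with (df := - (f1 (a / s) / (a / s))) (dg := - a / s ^ 2).
  - now apply H.
  - auto_derive; [lra|]. field. lra.
  - field. lra.
Qed.

(* Differentiating [N (1 / (4 w)) = 2 w N w], where [N = ev^2 + od^2], at the fixed point. *)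
Lemma self_dual_point :
  4 * (ev (/ 2) * ev1 (/ 2) + od (/ 2) * od1 (/ 2)) = ev (/ 2) * ev (/ 2) + od (/ 2) * od (/ 2).
Proof.
  set (N := fun t => ev t * ev t + od t * od t).
  set (M := 4 * (ev (/ 2) * ev1 (/ 2) + od (/ 2) * od1 (/ 2))).
  assert (HN : is_derive N (/ 2) (- M)).
  { eapply is_derive_value.
    - pose proof (is_derive_ev (/ 2) ltac:(lra)) as De.
      pose proof (is_derive_od (/ 2) ltac:(lra)) as Do.
      exact (is_derive_Rplus _ _ _ _ _
        (is_derive_Rmult _ _ _ _ _ De De) (is_derive_Rmult _ _ _ _ _ Do Do)).
    - unfold M. field. }
  assert (HI : is_derive (fun w => N (/ (4 * w))) (/ 2) M).
  { apply is_derive_Rcomp with (df := - M) (dg := -1).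
    - replace (/ (4 * / 2)) with (/ 2) by field. exact HN.
    - auto_derive; [lra|]. field.
    - ring. }
  (* The map [w -> 1/(4w)] has derivative -1 at [1/2], whence [M] above; the product [2 w N w] has
     derivative [2 N - M]. Equating them gives [M = N] at [1/2]. *)
  assert (HL : is_derive (fun w => N (/ (4 * w))) (/ 2) (2 * N (/ 2) + 2 * / 2 * - M)).
  { apply is_derive_ext_loc with (fun w => 2 * w * N w).
    - exists (mkposreal (/ 4) ltac:(lra)). intros w Hw.
      apply Rabs_def2 in Hw. unfold minus, plus, opp in Hw; simpl in Hw.
      assert (Hw0 : 0 < w) by lra. change (2 * w * N w = N (/ (4 * w))).
      unfold N. rewrite ev_dual, od_dual by exact Hw0.
      pose proof (sqrt_sqrt w ltac:(lra)) as Hq. rewrite <- Hq at 1. ring.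
    - apply (is_derive_Rmult (fun w => 2 * w)); [|exact HN].
      auto_derive; [trivial|ring]. }
  apply is_derive_unique in HI. apply is_derive_unique in HL. rewrite HI in HL.
  unfold N in HL. lra.
Qed.

(** * Monotonicity for [s >= 2r] *)

(** Minus the scaling derivative of [sqrt w (ev x ev w + od x od w)] in [x] and [w] jointly, divided
    by [sqrt w]; the last term comes from [sqrt w]. *)
Definition Phi (x w : R) : R :=
  ev1 x * ev w + ev x * ev1 w + od1 x * od w + od x * od1 w - (ev x * ev w + od x * od w) / 2.

(** With the halves grouped as [ev1 w - ev w / 2] and [od1 w - od w / 2], [Phi] is a sum of four
    products of a nonnegative function of [x] and a decreasing function of [w]. *)
Lemma Phi_decr x w : / 2 <= x -> / 2 <= w -> Phi x w <= Phi x (/ 2).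
Proof.
  intros Hx Hw.
  assert (Hy : / 2 <= / 2 <= w) by lra.
  pose proof (ev_decr w (/ 2) ltac:(lra)). pose proof (od_decr w (/ 2) ltac:(lra)).
  pose proof (ev1_half_shift_decr w (/ 2) Hy). pose proof (od1_half_shift_decr w (/ 2) Hy).
  pose proof (ev_ge_1 x ltac:(lra)). pose proof (od_nonneg x ltac:(lra)).
  pose proof (ev1_nonneg x ltac:(lra)). pose proof (od1_nonneg x ltac:(lra)).
  assert (A1 : ev1 x * ev w <= ev1 x * ev (/ 2)) by (apply Rmult_le_compat_l; lra).
  assert (A2 : od1 x * od w <= od1 x * od (/ 2)) by (apply Rmult_le_compat_l; lra).
  assert (A3 : ev x * (ev1 w - ev w / 2) <= ev x * (ev1 (/ 2) - ev (/ 2) / 2))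
    by (apply Rmult_le_compat_l; lra).
  assert (A4 : od x * (od1 w - od w / 2) <= od x * (od1 (/ 2) - od (/ 2) / 2))
    by (apply Rmult_le_compat_l; lra).
  unfold Phi. lra.
Qed.

Lemma Phi_nonpos x w : / 2 <= x -> / 2 <= w -> Phi x w <= 0.
Proof.
  intros Hx Hw. apply Rle_trans with (1 := Phi_decr x w Hx Hw).
  replace (Phi x (/ 2)) with (Phi (/ 2) x) by (unfold Phi; field).
  apply Rle_trans with (1 := Phi_decr (/ 2) x ltac:(lra) Hx).
  pose proof self_dual_point. unfold Phi. lra.
Qed.

Lemma F5_incr_far r a b : / 2 <= r -> 2 * r <= a <= b -> F5 r a <= F5 r b.
Proof.
  intros Hr Hab. rewrite !F5_dual by lra.
  apply Rmult_le_compat_l; [lra|].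
  assert (Hr0 : 0 < r) by lra.
  set (k := / (4 * r)). assert (Hk : 0 < k) by (apply Rinv_0_lt_compat; lra).
  assert (E : forall s, s / (4 * r) = k * s) by (intros; unfold k; field; lra).
  rewrite !E.
  apply (le_of_nonneg_derive
    (fun s => sqrt (k * s) * (ev (r * s) * ev (k * s) + od (r * s) * od (k * s)))
    (fun s => - (sqrt (k * s) / s * Phi (r * s) (k * s)))); [lra| |].
  - intros s Hs. assert (Hs0 : 0 < s) by lra. assert (Hks : 0 < k * s) by nra.
    eapply is_derive_value.
    + apply is_derive_Rmult.
      * apply is_derive_Rcomp with (df := / (2 * sqrt (k * s))) (dg := k) (l := sqrt (k * s) / (2 * s)).
        -- apply is_derive_Reals, derivable_pt_lim_sqrt, Hks.
        -- auto_derive; [trivial|ring].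
        -- pose proof (sqrt_lt_R0 _ Hks). pose proof (sqrt_sqrt (k * s) ltac:(lra)) as Hq.
           apply Rmult_eq_reg_r with (2 * s * sqrt (k * s)); [|nra].
           replace (sqrt (k * s) / (2 * s) * (2 * s * sqrt (k * s)))
             with (sqrt (k * s) * sqrt (k * s)) by (field; lra).
           rewrite Hq. field. lra.
      * exact (is_derive_Rplus _ _ _ _ _
          (is_derive_Rmult _ _ _ _ _ (is_derive_dilation ev ev1 r s is_derive_ev Hr0 Hs0)
             (is_derive_dilation ev ev1 k s is_derive_ev Hk Hs0))
          (is_derive_Rmult _ _ _ _ _ (is_derive_dilation od od1 r s is_derive_od Hr0 Hs0)
             (is_derive_dilation od od1 k s is_derive_od Hk Hs0))).
    + unfold Phi. field. lra.
  - intros s Hs. assert (Hs0 : 0 < s) by lra.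
    (* Here [s >= 2r >= 1], so both [r s] and [s/(4r)] are at least [1/2]. *)
    assert (HP : Phi (r * s) (k * s) <= 0).
    { apply Phi_nonpos; [nra|]. apply Rmult_le_reg_r with (4 * r); [lra|].
      unfold k. replace (/ (4 * r) * s * (4 * r)) with s by (field; lra). lra. }
    assert (0 <= sqrt (k * s) / s)
      by (apply Rmult_le_pos; [apply sqrt_pos|apply Rlt_le, Rinv_0_lt_compat; lra]).
    nra.
Qed.

(** * Monotonicity for [1 <= s <= 2r] *)

(** The derivative [s d/ds] of [pairing (r s) (r / s)], at [x = r s] and [y = r / s]. *)
Definition Psi (x y : R) : R :=
  (ev x + od x) * ev1 y - (ev y + od y) * ev1 x + (ev x - od x) * od1 y - (ev y - od y) * od1 x.

Lemma Psi_nonneg x y : / 2 <= y <= x -> 0 <= Psi x y.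
Proof.
  intros Hy. unfold Psi.
  (* The gap [10 (x - y)] of [ev + od] is at most [(ev x + od x) * 10 (x - y)] because [ev x >= 1];
     the decay of [ev1] pays for it. *)
  assert (A1 : (ev y + od y) * ev1 x <= (ev x + od x) * ev1 y).
  { pose proof (ev1_decay x y Hy). pose proof (ev_add_od_gap x y Hy).
    pose proof (ev_ge_1 x ltac:(lra)). pose proof (od_nonneg x ltac:(lra)).
    pose proof (ev1_nonneg x ltac:(lra)).
    apply Rle_trans with ((ev x + od x) * (ev1 x * (1 + 10 * (x - y)))).
    - apply Rle_trans with ((ev x + od x + 10 * (x - y)) * ev1 x);
        [apply Rmult_le_compat_r; lra|].
      assert (0 <= (ev x + od x - 1) * (10 * (x - y)) * ev1 x)
        by (apply Rmult_le_pos; [apply Rmult_le_pos|]; lra). lra.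
    - apply Rmult_le_compat_l; lra. }
  (* Since [od y <= 1 <= ev y], both factors on the left are nonnegative and the two monotonicities
     multiply. *)
  assert (A2 : (ev y - od y) * od1 x <= (ev x - od x) * od1 y).
  { pose proof (od1_decr x y Hy). pose proof (ev_sub_od_incr x y Hy).
    pose proof (ev_ge_1 y ltac:(lra)). pose proof (od_le_1 y ltac:(lra)).
    pose proof (od1_nonneg x ltac:(lra)). apply Rmult_le_compat; lra. }
  lra.
Qed.

Lemma F5_incr_near r a b : 0 < r -> 1 <= a <= b -> b <= 2 * r -> F5 r a <= F5 r b.
Proof.
  intros Hr Hab Hb. rewrite !F5_pairing by lra.
  apply (le_of_nonneg_derive (fun s => pairing (r * s) (r / s))
    (fun s => Psi (r * s) (r / s) / s)); [lra| |].
  - intros s Hs. assert (Hs0 : 0 < s) by lra.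
    apply is_derive_ext with (fun s => (ev (r * s) * ev (r / s) + ev (r * s) * od (r / s))
      + (od (r * s) * ev (r / s) + (-1) * (od (r * s) * od (r / s)))).
    { intros t. match goal with |- ?a = ?b => change (@eq R a b) end. unfold pairing. ring. }
    eapply is_derive_value.
    + pose proof (is_derive_dilation ev ev1 r s is_derive_ev Hr Hs0) as DE.
      pose proof (is_derive_dilation od od1 r s is_derive_od Hr Hs0) as DO.
      pose proof (is_derive_inverse_dilation ev ev1 r s is_derive_ev Hr Hs0) as De.
      pose proof (is_derive_inverse_dilation od od1 r s is_derive_od Hr Hs0) as Do.
      exact (is_derive_Rplus _ _ _ _ _
        (is_derive_Rplus _ _ _ _ _
          (is_derive_Rmult _ _ _ _ _ DE De) (is_derive_Rmult _ _ _ _ _ DE Do))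
        (is_derive_Rplus _ _ _ _ _ (is_derive_Rmult _ _ _ _ _ DO De)
          (is_derive_scal _ _ (-1) _ (is_derive_Rmult _ _ _ _ _ DO Do)))).
    + unfold Psi. simpl. field. lra.
  - intros s Hs. apply Rmult_le_pos; [|apply Rlt_le, Rinv_0_lt_compat; lra].
    (* [s <= 2r] gives [r / s >= 1/2], and [s >= 1] gives [r / s <= r s]. *)
    apply Psi_nonneg. split.
    + apply Rmult_le_reg_r with s; [lra|]. unfold Rdiv. rewrite Rmult_assoc, Rinv_l; lra.
    + apply Rmult_le_reg_r with s; [lra|]. unfold Rdiv. rewrite Rmult_assoc, Rinv_l by lra.
      assert (1 <= s * s) by nra. nra.
Qed.

(** * Conclusion by the two reflections *)

Lemma F5_min_large r s : / 2 <= r -> 0 < s -> F5 r 1 <= F5 r s.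
Proof.
  intros Hr Hs0.
  assert (H : forall s, 1 <= s -> F5 r 1 <= F5 r s).
  { intros t Ht. destruct (Rle_or_lt t (2 * r)) as [H|H].
    - apply F5_incr_near; lra.
    - apply Rle_trans with (F5 r (2 * r)); [apply F5_incr_near; lra|apply F5_incr_far; lra]. }
  destruct (Rle_or_lt 1 s) as [Hs|Hs]; [now apply H|].
  rewrite <- (F5_reflect_s r s) by lra. apply H.
  rewrite <- Rinv_1. apply Rinv_le_contravar; lra.
Qed.

Theorem theorem5 (r : R) (hr : 0 < r) :
  forall s : R, 0 < s -> F5 r 1 <= F5 r s.
Proof.
  intros s Hs. destruct (Rle_or_lt (/ 2) r) as [H|H]; [now apply F5_min_large|].
  (* The reflected parameter lies in the range already treated, and the reflection factor [2 r] is
     positive and independent of [s]. *)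
  assert (Hr4 : / 2 <= / (4 * r)) by (apply Rinv_le_contravar; lra).
  pose proof (F5_min_large _ s Hr4 Hs) as Hm.
  rewrite !F5_reflect_r in Hm by lra.
  apply Rmult_le_reg_l with (2 * r); [lra|exact Hm].
Qed.
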